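(* (i) There exists an absolute constant $C>0$ such that for every integer $d>2$ and every $n$-vertex $d$-regular graph $G$, $$\operatorname{tww}(G)\le n^{\frac{d-2}{2d-2}}\cdot\exp\left(C\left(d^{-1}\sqrt{\log n}\cdot\log\log n+\log d\right)\right).$$ (ii) For every fixed $\varepsilon>0$ there exists a constant $C>0$ (depending only on $\varepsilon$) such that if $G$ is a uniformly random graph on $n$ vertices with $m$ edges, where $m=m(n)\ge(1+\varepsilon)n$, and $d=\operatorname{mad}(G)$, then with high probability (i.e. with probability tending to $1$ as $n\to\infty$) $$\operatorname{tww}(G)\le n^{\frac{d-2}{2d-2}}\cdot\exp\left(C\left(d^{-1}\sqrt{\log n}\cdot\log\log n+\log d\right)\right).$$
   Context: All graphs are finite and simple; random graphs have vertex set $\{1,\dots,n\}$; $\log$ is the natural logarithm. The maximum average degree of a graph $G$ is $\operatorname{mad}(G)=\max_{H}\frac{2e(H)}{v(H)}$, over all subgraphs $H$ of $G$ with at least one vertex, where $v(H)$ and $e(H)$ are the numbers of vertices and edges of $H$. Twin-width: a trigraph is a finite vertex set together with two disjoint sets of edges (unordered pairs of distinct vertices), called black and red; a graph is regarded as a trigraph with all edges black. Contracting two distinct (not necessarily adjacent) vertices $u,v$ of a trigraph means replacing them by a new vertex $w$ where, for each other vertex $x$: $wx$ is a black edge if both $ux$ and $vx$ are black edges; $wx$ is a non-edge if neither $ux$ nor $vx$ is an edge (of either colour); and $wx$ is a red edge otherwise; all other edges are unchanged. The twin-width $\operatorname{tww}(G)$ is the minimum integer $w\ge 0$ such that there is a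 sequence of contractions from $G$ to a one-vertex trigraph in which, in every trigraph of the sequence, every vertex is incident with at most $w$ red edges. *)

(* Defs.v *)
From HB Require Import structures.
From mathcomp Require Import all_boot all_order all_algebra.
From mathcomp Require Import all_classical all_reals all_analysis.
Import numFieldNormedType.Exports.
Import Order.TTheory GRing.Theory Num.Theory.

Set Implicit Arguments.
Unset Strict Implicit.
Unset Printing Implicit Defensive.

Local Open Scope ring_scope.

(** * Finite simple graphs *)

Record graph (T : finType) := Graph {
  edges : {set {set T}};
  edges_card2 : edges \subset [set e : {set T} | #|e| == 2%N] }.

HB.instance Definition _ (T : finType) := [isSub for @edges T].
HB.instance Definition _ (T : finType) := [Finite of graph T by <:].

Definition adj (T : finType) (G : graph T) : rel T :=
  fun x y => [set x; y] \in edges G.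

Lemma adj_sym (T : finType) (G : graph T) : symmetric (adj G).
Proof. by move=> x y; rewrite /adj finset.setUC. Qed.

Lemma adj_irrefl (T : finType) (G : graph T) : irreflexive (adj G).
Proof.
move=> x; apply/negP => /(fintype.subsetP (edges_card2 G)).
by rewrite inE finset.setUid cards1.
Qed.

Definition regular (T : finType) (d : nat) (G : graph T) : Prop :=
  forall x : T, #|[set y | adj G x y]| = d.

(* [H.1] is the vertex set and [H.2] the edge set. *)
Definition nonempty_subgraph (T : finType) (G : graph T)
    (H : {set T} * {set {set T}}) : bool :=
  [&& (0 < #|H.1|)%N, H.2 \subset edges G &
      [forall e in H.2, e \subset H.1]].

(* All the ratios are nonnegative, so the default value 0 only matters for the
   graph with no vertices. *)
Definition mad (R : realType) (T : finType) (G : graph T) : R :=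
  \big[Num.max/0]_(H : {set T} * {set {set T}} | nonempty_subgraph G H)
    (2 * #|H.2|%:R / #|H.1|%:R).

(** * Trigraphs and twin-width *)

Record trigraph := Trigraph {
  vertex :> finType;
  black : rel vertex;
  red : rel vertex;
  black_sym : symmetric black;
  red_sym : symmetric red;
  black_irrefl : irreflexive black;
  red_irrefl : irreflexive red;
  black_red_disjoint : forall x y, ~~ (black x y && red x y) }.

Arguments black {t} _ _.
Arguments red {t} _ _.

Lemma no_red_disjoint (T : finType) (e : rel T) (x y : T) :
  ~~ (e x y && false).
Proof. by rewrite andbF. Qed.

Definition trigraph_of (T : finType) (G : graph T) : trigraph :=
  @Trigraph T (adj G) (fun _ _ => false)
    (@adj_sym T G) (fun _ _ => erefl)
    (@adj_irrefl T G) (fun _ => erefl)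
    (@no_red_disjoint T (adj G)).

Section Contraction.

Variables (G : trigraph) (u v : G).

(* [None] is the vertex replacing [u] and [v]. *)
Definition contract_vertex : finType :=
  option {x : G | (x != u) && (x != v)}.

Definition to_black (x : G) : bool := black u x && black v x.

Definition to_nonedge (x : G) : bool :=
  ~~ (black u x || red u x) && ~~ (black v x || red v x).

Definition to_red (x : G) : bool := ~~ to_black x && ~~ to_nonedge x.

Definition contract_black : rel contract_vertex := fun x y =>
  match x, y with
  | Some a, Some b => black (val a) (val b)
  | None, Some a | Some a, None => to_black (val a)
  | None, None => false
  end.

Definition contract_red : rel contract_vertex := fun x y =>
  match x, y with
  | Some a, Some b => red (val a) (val b)
  | None, Some a | Some a, None => to_red (val a)
  | None, None => false
  end.

Lemma contract_black_sym : symmetric contract_black.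
Proof. by case=> [a|] [b|] //=; rewrite black_sym. Qed.

Lemma contract_red_sym : symmetric contract_red.
Proof. by case=> [a|] [b|] //=; rewrite red_sym. Qed.

Lemma contract_black_irrefl : irreflexive contract_black.
Proof. by case=> [a|] //=; rewrite black_irrefl. Qed.

Lemma contract_red_irrefl : irreflexive contract_red.
Proof. by case=> [a|] //=; rewrite red_irrefl. Qed.

Lemma contract_disjoint x y : ~~ (contract_black x y && contract_red x y).
Proof.
case: x y => [a|] [b|] //=; first exact: black_red_disjoint.
- by rewrite /to_red; case: (to_black _).
- by rewrite /to_red; case: (to_black _).
Qed.

Definition contract : trigraph :=
  @Trigraph contract_vertex contract_black contract_red
    contract_black_sym contract_red_sym
    contract_black_irrefl contract_red_irrefl contract_disjoint.

End Contraction.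

Definition red_degree_le (w : nat) (G : trigraph) : Prop :=
  forall x : G, (#|[set y : G | red x y]| <= w)%N.

Inductive contraction_seq (w : nat) : trigraph -> Prop :=
| contraction_seq_point (G : trigraph) :
    #|G| = 1%N -> red_degree_le w G -> contraction_seq w G
| contraction_seq_step (G : trigraph) (u v : G) :
    u != v -> red_degree_le w G -> contraction_seq w (contract u v) ->
    contraction_seq w G.

(* The graph with no vertices has no contraction sequence; it gets the junk
   value 0. *)
Definition tww (T : finType) (G : graph T) : nat :=
  match pselect (exists w, `[< contraction_seq w (trigraph_of G) >]) with
  | left ex => ex_minn ex
  | right _ => 0%N
  end.

Lemma card_contract (G : trigraph) (u v : G) :
  u != v -> #|contract u v|.+1 = #|G|.
Proof.
move=> uv; rewrite /contract /= /contract_vertex card_option card_sig.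
have -> : #|[pred x : G | (x != u) && (x != v)]| = #|~: [set u; v]|.
  by apply: eq_card => x; rewrite !inE negb_or.
by rewrite -(cardsC [set u; v]) cards2 uv.
Qed.

Lemma contraction_seq_exists (w : nat) (G : trigraph) :
  (0 < #|G| <= w)%N -> contraction_seq w G.
Proof.
move: {2}#|G| (erefl #|G|) => n; elim: n G => [|n IH] G cG /andP[G0 Gw].
  by rewrite cG in G0.
have dG : red_degree_le w G by move=> x; apply: leq_trans (max_card _) Gw.
case: n => [|n] in IH cG *; first exact: contraction_seq_point.
have /card_gt1P[u [v [_ _ uv]]] : (1 < #|[set: G]|)%N by rewrite cardsT cG.
have cC : #|contract u v| = n.+1.
  by apply: succn_inj; rewrite card_contract.
apply: (contraction_seq_step uv dG); apply: IH => //.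
by rewrite cC /=; apply: leq_trans Gw; rewrite cG.
Qed.

Lemma twwP (T : finType) (G : graph T) : (0 < #|T|)%N ->
  contraction_seq (tww G) (trigraph_of G) /\
  forall w, contraction_seq w (trigraph_of G) -> (tww G <= w)%N.
Proof.
move=> T0; rewrite /tww; case: pselect => [ex|[]]; last first.
  by exists #|T|; apply/asboolP/contraction_seq_exists; rewrite T0 /=.
case: ex_minnP => w /asboolP Pw min_w; split=> // w' Pw'.
by apply: min_w; apply/asboolP.
Qed.

(** * The bound and the random graph *)

Definition tww_bound (R : realType) (C : R) (n : nat) (d : R) : R :=
  n%:R `^ ((d - 2) / (2 * d - 2)) *
  expR (C * (d^-1 * Num.sqrt (ln n%:R) * ln (ln n%:R) + ln d)).

(* Probability of [P] for the uniform distribution on the graphs with vertex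
   set ['I_n] and exactly [m] edges; meaningful when [m <= 'C(n, 2)]. *)
Definition prob_Gnm (R : realType) (n m : nat) (P : pred (graph 'I_n)) : R :=
  #|[set G : graph 'I_n | (#|edges G| == m) && P G]|%:R /
  #|[set G : graph 'I_n | #|edges G| == m]|%:R.

(* Main.v *)
Require Import Defs.
From mathcomp Require Import all_boot zify boolp.

Set Implicit Arguments.
Unset Strict Implicit.
Unset Printing Implicit Defensive.

(** Give every vertex a label of [L] bits with [2 ^ L] about [n ^ (d / (2 d - 2))],
    contract the vertices with equal labels, and then forget the bits one at a
    time, from the last one.  The red degree stays small if the label classes have
    size [O(n / 2 ^ L)] and if the labels of the ends of any edge agree on about
    [2 L / d] positions, taken from few possible sets of positions: then a label
    prefix is joined to about [2 ^ (L (1 - 2 / d))] others.  Both quantities are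
    about [n ^ ((d - 2) / (2 d - 2))].

    As each edge set [A] covers at least [2 |A| / d] vertices, Hall's and Koenig's
    theorems yield [D], about [k0 d / 2], partial functional graphs (each vertex
    selects at most one incident edge) such that every edge occurs in exactly [k0]
    of them.  The bits use these graphs cyclically; the [i]-th bit is a random
    colouring of the components of its graph, so it agrees on the ends of the
    edges of that graph.  To make the components small, the graphs are cut at
    depths congruent to [r] modulo [k], where [r] also varies cyclically, so that
    an edge is lost only once in [k] of its occurrences.  With
    [k = c log n / log Delta] the components have size at most a small power of
    [n], and exponential moments show that each bit halves all the classes almost
    exactly.  The choice of [k0], about [sqrt (log n) / d], balances the rounding
    of [k0 d / 2] and the number of sets of positions.

    For the random graph only the first moment of the number of vertices of large
    degree is needed, and [2 m / n <= mad G]. *)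

(** * Decomposition of the edges into functional graphs *)

Section Hall.
Variables (A B : finType) (r : A -> B -> bool).

Definition nbhood (S : {set A}) : {set B} := [set b | [exists a in S, r a b]].

Lemma nbhoodU S1 S2 : nbhood (S1 :|: S2) = nbhood S1 :|: nbhood S2.
Proof.
apply/setP => b; rewrite !inE; apply/existsP/orP => [[a /andP[]]|].
  by rewrite inE => /orP[] aS ab; [left|right]; apply/existsP; exists a; rewrite aS.
by case=> /existsP[a /andP[aS ab]]; exists a; rewrite inE aS ?orbT.
Qed.

(* Halmos and Vaughan's induction, splitting along a tight set if there is one. *)
Lemma hall_on (b0 : B) (A0 : {set A}) (B0 : {set B}) :
  (forall S : {set A}, S \subset A0 -> #|S| <= #|nbhood S :&: B0|)%N ->
  exists f : A -> B, {in A0 &, injective f} /\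
    {in A0, forall a, r a (f a) && (f a \in B0)}.
Proof.
have [n] := ubnP #|A0|; elim: n A0 B0 => // n IH A0 B0; rewrite ltnS => An hall.
have [->|[a0 a0A]] := set_0Vmem A0.
  by exists (fun _ => b0); split=> x; rewrite inE.
case: (pickP [pred S : {set A} | [&& S \proper A0, S != set0 &
    #|S| == #|nbhood S :&: B0|]]) => [S /and3P[SA S0 /eqP tight]|none].
(* The tight set is matched into its own neighbours. The rest still satisfies the condition in what
   is left of [B0]: the condition holds for [S :|: S'], and [S] accounts for exactly [#|S|]
   neighbours. *)
- have [f1 [f1i f1P]] : exists f : A -> B, {in S &, injective f} /\
      {in S, forall a, r a (f a) && (f a \in nbhood S :&: B0)}.
    apply: IH => [|S' S'S]; first exact: leq_trans (proper_card SA) An.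
    have -> : nbhood S' :&: (nbhood S :&: B0) = nbhood S' :&: B0.
      rewrite setIA; congr (_ :&: _); apply/setIidPl.
      by rewrite -(setUidPr S'S) nbhoodU subsetUl.
    exact/hall/(subset_trans S'S)/proper_sub.
  have [f2 [f2i f2P]] : exists f : A -> B, {in A0 :\: S &, injective f} /\
      {in A0 :\: S, forall a, r a (f a) && (f a \in B0 :\: nbhood S)}.
    apply: IH => [|S' S'D].
      apply: leq_trans An; apply: proper_card; rewrite properEneq subsetDl andbT.
      apply: contraNneq S0 => AS; rewrite -subset0; apply/subsetP => x xS.
      have := subsetP (proper_sub SA) _ xS.
      by rewrite -AS !inE xS.
    have dis : [disjoint S & S'].
      rewrite disjoint_sym; apply: disjointWl S'D _.
      by rewrite -setI_eq0 setIDAC setDIl setDv setI0.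
    have /hall : S :|: S' \subset A0.
      rewrite subUset proper_sub //=; apply: subset_trans S'D _.
      exact: subsetDl.
    rewrite (_ : _ :&: B0 = (nbhood S :&: B0) :|: (nbhood S' :&: (B0 :\: nbhood S))).
      have dB : (nbhood S :&: B0) :&: (nbhood S' :&: (B0 :\: nbhood S)) = set0.
        apply/setP => b; rewrite !inE.
        by case: [exists a in S, r a b]; rewrite //= !andbF.
      rewrite !cardsU (disjoint_setI0 dis) dB cards0 !subn0 tight.
      by rewrite cards0 subn0 leq_add2l.
    rewrite nbhoodU; apply/setP => b; rewrite !inE.
    by case: [exists a in S, _]; case: [exists a in S', _]; case: (b \in B0).
  have dis a a' : a \in S -> a' \in A0 -> a' \notin S -> f1 a <> f2 a'.
    move=> aS aA aS' e; have /andP[_] := f1P _ aS; rewrite inE => /andP[+ _].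
    have /f2P/andP[_] : a' \in A0 :\: S by rewrite inE aA aS'.
    by rewrite inE e => /andP[/negPf->].
  exists (fun a => if a \in S then f1 a else f2 a); split.
    move=> a a' aA aA'; case: ifPn => aS; case: ifPn => aS'.
    + exact: f1i.
    + by move/(dis _ _ aS aA' aS').
    + by move/esym/(dis _ _ aS' aA aS).
    + by apply: f2i; rewrite inE ?aS ?aS'.
  move=> a aA; case: ifPn => aS.
    by have := f1P _ aS; rewrite inE => /and3P[-> _ ->].
  have /f2P : a \in A0 :\: S by rewrite inE aS.
  by rewrite inE => /and3P[-> _ ->].
(* Without a tight set every nonempty proper subset has a spare neighbour, so any one pair may be
   matched and removed. *)
have strict (S : {set A}) : S \proper A0 -> S != set0 ->
    (#|S| < #|nbhood S :&: B0|)%N.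
  move=> SA S0; have := none S; rewrite /= SA S0 /= ltn_neqAle => ->.
  exact/hall/proper_sub.
have : (0 < #|nbhood [set a0] :&: B0|)%N.
  by rewrite -(cards1 a0) (leq_trans _ (hall _ _)) ?sub1set ?cards1.
case/card_gt0P => b; rewrite !inE => /andP[/existsP[a]].
rewrite inE => /andP[/eqP-> a0b bB].
have [f [fi fP]] : exists f : A -> B, {in A0 :\ a0 &, injective f} /\
    {in A0 :\ a0, forall a, r a (f a) && (f a \in B0 :\ b)}.
  apply: IH => [|S SA]; first by move: An; rewrite (cardsD1 a0) a0A.
  have [->|S0] := eqVneq S set0; first by rewrite cards0.
  have /strict/(_ S0) : S \proper A0 by apply: sub_proper_trans SA (properD1 a0A).
  rewrite (cardsD1 b) setIDA; case: (_ \in _); rewrite ?ltnS //.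
  exact: ltnW.
exists (fun a => if a == a0 then b else f a); split.
  move=> x y xA yA; case: eqP => [->|/eqP xa]; case: eqP => [->|/eqP ya] //.
  - have /fP/andP[_] : y \in A0 :\ a0 by rewrite !inE ya.
    by rewrite !inE => /andP[/negPf fb _] /esym/eqP; rewrite fb.
  - have /fP/andP[_] : x \in A0 :\ a0 by rewrite !inE xa.
    by rewrite !inE => /andP[/negPf fb _] /eqP; rewrite fb.
  - by apply: fi; rewrite !inE ?xa ?ya.
move=> x xA; case: eqP => [->|/eqP xa]; first by rewrite a0b.
have /fP : x \in A0 :\ a0 by rewrite !inE xa.
by rewrite !inE => /and3P[-> _ ->].
Qed.

End Hall.

(** Induction on [D]: the mass [D * #|S|] of the rows in [S] lies in the columns of its
    neighbourhood, each of mass [D]. So Hall's condition holds in the support, and removing a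
    perfect matching lowers every sum by one. *)
Lemma birkhoff (X Y : finType) (D : nat) (m : X -> Y -> nat) :
  (forall x, \sum_y m x y = D)%N -> (forall y, \sum_x m x y = D)%N ->
  exists F : 'I_D -> X -> Y, (forall a, injective (F a)) /\
    forall x y, #|[set a | F a x == y]| = m x y.
Proof.
elim: D m => [|D IH] m row col.
  have no (a : 'I_0) : False by case: a.
  exists (fun a => False_rect _ (no a)); split=> [a|x y]; first by case: (no a).
  rewrite eq_card0 => [|a]; last by case: (no a).
  by apply/esym/eqP; rewrite -leqn0 -(row x) (bigD1 y) //= leq_addr.
have XY : #|X| = #|Y|.
  apply/eqP; rewrite -(eqn_pmul2r (ltn0Sn D)) -!sum_nat_const.
  rewrite -(eq_bigr _ (fun x _ => row x)) -(eq_bigr _ (fun y _ => col y)).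
  by rewrite exchange_big.
have [XE|[x0 _]] := set_0Vmem [set: X]; last first.
  have [f [fi fP]] : exists f : X -> Y, injective f /\ forall x, (0 < m x (f x))%N.
    have [y0 _] : exists y : Y, true.
      have : (0 < #|Y|)%N by rewrite -XY; apply/card_gt0P; exists x0.
      by case/card_gt0P => y _; exists y.
    case: (@hall_on X Y (fun x y => 0 < m x y)%N y0 [set: X] [set: Y]).
      move=> S _; rewrite setIT -(leq_pmul2r (ltn0Sn D)) -!sum_nat_const.
      rewrite -(eq_bigr _ (fun x _ => row x)) -(eq_bigr _ (fun y _ => col y)).
      rewrite [leqRHS]exchange_big /=.
      rewrite (eq_bigr (fun x => \sum_(y in nbhood (fun x y => 0 < m x y) S) m x y))%N.
        rewrite [leqRHS](bigID (mem S)) /= ; exact: leq_addr.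
      move=> x xS; rewrite [RHS]big_mkcond; apply: eq_bigr => y _.
      case: ifPn => //; rewrite inE negb_exists => /forallP/(_ x).
      by rewrite xS /= lt0n negbK => /eqP.
    move=> f [fi fP]; exists f; split=> [x y|x]; first exact: fi.
    by have /andP[] := fP x (in_setT x).
  have [g fK gK] : bijective f by apply: inj_card_bij fi _; rewrite XY.
  have sum_f x : (\sum_y (y == f x) = 1)%N.
    by rewrite (bigD1 (f x)) //= eqxx big1 // => y /negPf->.
  have sum_g y : (\sum_x (y == f x) = 1)%N.
    rewrite (bigD1 (g y)) //= gK eqxx big1 // => x.
    by apply: contraNeq; rewrite eqb0 negbK => /eqP->; rewrite fK.
  have lem x y : ((y == f x) <= m x y)%N by case: eqP => // ->; apply: fP.
  case: (IH (fun x y => m x y - (y == f x))%N) => [x|y|F [Fi FE]].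
  - by rewrite sumnB // row sum_f subn1.
  - by rewrite sumnB // col sum_g subn1.
  exists (fun a => if unlift ord0 a is Some b then F b else f); split=> [a|x y].
    by case: unliftP.
  rewrite -sum1dep_card big_mkcond big_ord_recl /= unlift_none.
  under eq_bigr => i _ do rewrite liftK.
  rewrite -big_mkcond /= sum1dep_card FE [f x == y]eq_sym.
  by have := lem x y; case: eqP => _ /=; lia.
have /eqP X0 : #|X| == 0 by rewrite -cardsT XE cards0.
have Y0 : #|Y| = 0 by rewrite -XY.
have noX (x : X) : False by have := fintype0 x X0.
by exists (fun _ x => False_rect _ (noX x)); split=> [a x|x]; case: (noX x).
Qed.

(* The matrix of multiplicities is completed to one with constant row and column
   sums by adding its transpose and two diagonal blocks. *)
Lemma konig_colouring (X Y : finType) (D : nat) (m : X -> Y -> nat) :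
  (forall x, \sum_y m x y <= D)%N -> (forall y, \sum_x m x y <= D)%N ->
  exists M : 'I_D -> X -> option Y,
    (forall a x x' y, M a x = Some y -> M a x' = Some y -> x = x') /\
    forall x y, #|[set a | M a x == Some y]| = m x y.
Proof.
move=> row col.
pose w (s : X + Y) (t : Y + X) : nat := match s, t with
  | inl x, inl y => m x y
  | inr y, inr x => m x y
  | inl x, inr x' => if x == x' then D - \sum_y m x y else 0
  | inr y, inl y' => if y == y' then D - \sum_x m x y else 0
  end.
case: (@birkhoff (X + Y)%type (Y + X)%type D w) => [[x|y]|[y|x]|F [Fi FE]].
- rewrite big_sumType /= -big_mkcond /= (big_pred1 x) => [|x']; last exact: eq_sym.
  by rewrite subnKC.
- rewrite big_sumType /= -big_mkcond /= (big_pred1 y) => [|x']; last exact: eq_sym.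
  by rewrite subnK.
- rewrite big_sumType /= -big_mkcond /= (big_pred1 y) //.
  by rewrite subnKC.
- rewrite big_sumType /= -big_mkcond /= (big_pred1 x) //.
  by rewrite subnK.
exists (fun a x => if F a (inl x) is inl y then Some y else None); split.
  move=> a x x' y; case E: (F a (inl x)) => [z|//] [zy].
  case E': (F a (inl x')) => [z'|//] [z'y].
  by have [] // : inl Y x = inl Y x' by apply: (Fi a); rewrite E E' zy z'y.
move=> x y; rewrite -[RHS](FE (inl x) (inl y)); apply: eq_card => a; rewrite !inE.
by case: (F a (inl x)).
Qed.

(** Hall's theorem for [k] copies of each edge and [D] copies of each vertex assigns every copy to
    an end, no vertex receiving more than [D]. These incidences form a bipartite multigraph of
    degree at most [D]; its colour classes are the maps [M a]. *)
Lemma edge_decomposition (T : finType) (E : {set {set T}}) (k D : nat) :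
  k <= D ->
  (forall A : {set {set T}}, A \subset E -> k * #|A| <= D * #|cover A|) ->
  exists M : 'I_D -> T -> option {set T},
    [/\ forall a v v' e, M a v = Some e -> M a v' = Some e -> v = v',
        forall a v e, M a v = Some e -> (v \in e) && (e \in E) &
        forall e, e \in E -> #|[set p : 'I_D * T | M p.1 p.2 == Some e]| = k].
Proof.
move=> kD hall.
have [m [row col mE mP]] : exists m : T -> {set T} -> nat,
   [/\ forall v, \sum_e m v e <= D, forall e, \sum_v m v e <= k,
     forall e, e \in E -> \sum_v m v e = k &
     forall v e, 0 < m v e -> (v \in e) && (e \in E)].
  (* If there are no vertex copies, the density hypothesis forces [k = 0] as soon as there is an
     edge, so the zero matrix works. *)
  case: (pickP (fun _ : T * 'I_D => true)) => [b0 _|none]; last first.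
    exists (fun _ _ => 0); split=> //; try by move=> *; rewrite big1.
    move=> e eE; rewrite big1 //; apply/esym/eqP; rewrite -leqn0.
    have := hall [set e]; rewrite cards1 muln1 sub1set => /(_ eE)/leq_trans; apply.
    rewrite leqn0 -(card_ord D) mulnC -leqn0.
    by rewrite (leq_trans (leq_mul (max_card _) (leqnn _))) // -card_prod eq_card0.
  have [f [fi fP]] : exists f : {set T} * 'I_k -> T * 'I_D,
      {in setX E [set: 'I_k] &, injective f} /\
      {in setX E [set: 'I_k], forall x, ((f x).1 \in x.1) && (f x \in [set: T * 'I_D])}.
    apply: (@hall_on _ _ (fun (x : {set T} * 'I_k) (y : T * 'I_D) => y.1 \in x.1) b0).
    move=> S SE; rewrite setIT.
    have AE : fst @: S \subset E.
      by apply/subsetP => e /imsetP[x /(subsetP SE) + ->]; rewrite inE => /andP[].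
    have SA : #|S| <= k * #|fst @: S|.
      rewrite -[X in X * _](card_ord k) -cardsT mulnC -cardsX.
      apply/subset_leq_card/subsetP.
      by move=> x xS; rewrite !inE andbT imset_f.
    apply: leq_trans SA (leq_trans (hall _ AE) _).
    rewrite -[X in X * _](card_ord D) -cardsT mulnC -cardsX.
    apply/subset_leq_card/subsetP.
    move=> [v a]; rewrite !inE andbT /= => /bigcupP[e /imsetP[x xS ->] vx].
    by apply/existsP; exists x; rewrite xS.
  pose m v e := if e \in E then #|[set c : 'I_k | (f (e, c)).1 == v]| else 0.
  have mE e : e \in E -> \sum_v m v e = k.
    move=> eE; rewrite /m eE -[RHS](card_ord k) -sum1_card.
    rewrite (partition_big (fun c => (f (e, c)).1) predT) //=.
    by apply: eq_bigr => v _; rewrite sum1dep_card.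
  exists m; split=> [v|e|//|v e].
  - rewrite /m -big_mkcond /=.
    pose S := [set x in setX E [set: 'I_k] | (f x).1 == v].
    have -> : \sum_(e in E) #|[set c : 'I_k | (f (e, c)).1 == v]| = #|S|.
      under eq_bigr => e _ do rewrite -sum1dep_card.
      rewrite pair_big_dep /= -sum1_card; apply: eq_bigl => -[e c].
      by rewrite !inE andbT.
    rewrite -(card_in_imset (f := fun x => (f x).2)); last first.
      move=> x y; rewrite inE => /andP[xE /eqP xv]; rewrite inE => /andP[yE /eqP yv].
      by move=> xy; apply: fi => //; rewrite [LHS]surjective_pairing xv xy -yv -surjective_pairing.
    by rewrite -[leqRHS](card_ord D) max_card.
  - have [/mE->//|/negPf eE] := boolP (e \in E).
    by rewrite big1 // => v _; rewrite /m eE.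
  rewrite /m; case: ifP => // eE /card_gt0P[c]; rewrite inE => /eqP <-.
  by have := fP (e, c); rewrite !inE eE => /(_ isT)/andP[-> _].
have [M [Mi Mm]] := konig_colouring row (fun e => leq_trans (col e) kD).
exists M; split=> // [a v e Me|e eE].
  by apply: mP; rewrite -Mm; apply/card_gt0P; exists a; rewrite inE Me.
rewrite -(mE e eE) -sum1dep_card; under [RHS]eq_bigr => v _ do rewrite -Mm -sum1dep_card.
by rewrite (exchange_big_dep predT) //= pair_big_dep.
Qed.

(** * Cutting functional graphs into small pieces *)

Section FunctionalGraph.
Variables (T : finType) (g : T -> T).

Lemma fconnect_iterP (x y : T) : reflect (exists i, iter i g x = y) (fconnect g x y).
Proof.
apply: (iffP idP) => [xy|[i <-]]; last exact: fconnect_iter.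
by exists (findex g x y); rewrite iter_findex.
Qed.

(* The recurrent points of [v] form the cycle that its orbit eventually enters. *)
Definition recurrent (v y : T) : bool := [forall z, fconnect g v z ==> fconnect g z y].

Lemma recurrent_exists (v : T) : exists y, recurrent v y.
Proof.
case: (@arg_minnP _ v (fconnect g v) (fun y => #|fconnect g y|) (connect0 _ _)).
move=> y vy ymin; exists y; apply/forallP => x; apply/implyP => vx.
have [/fconnect_iterP[i iv] /fconnect_iterP[j jv]] := (vy, vx).
have [ij|ij] := leqP j i.
  by rewrite -iv -jv -(subnK ij) iterD fconnect_iter.
have yx : fconnect g y x by rewrite -iv -jv -(subnK (ltnW ij)) iterD fconnect_iter.
have sub : fconnect g x \subset fconnect g y.
  by apply/subsetP => u xu; apply: connect_trans yx xu.
have : fconnect g y \subset fconnect g x.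
  by have := ymin x vx; rewrite -(geq_leqif (subset_leqif_card sub)).
by move/subsetP; apply; apply: connect0.
Qed.

Lemma recurrent_step (v : T) : recurrent (g v) =1 recurrent v.
Proof.
move=> y; apply/forallP/forallP => H z; apply/implyP => vz; last first.
  by apply: (implyP (H z)); apply: connect_trans (fconnect1 g v) vz.
have /fconnect_iterP[[|i] <-] := vz; last first.
  by apply: (implyP (H _)); rewrite iterSr fconnect_iter.
by apply: connect_trans (fconnect1 g v) _; apply: (implyP (H _)); exact: connect0.
Qed.

Definition base (v : T) : T := odflt v (pick (recurrent v)).

Lemma base_step (v : T) : base (g v) = base v.
Proof.
rewrite /base (eq_pick (recurrent_step v)); case: pickP => // no.
by have [y] := recurrent_exists v; rewrite no.
Qed.

Lemma base_iter (t : nat) (v : T) : base (iter t g v) = base v.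
Proof. by elim: t => //= t IH; rewrite base_step. Qed.

Lemma base_reached (v : T) : exists t, iter t g v == base v.
Proof.
have : recurrent v (base v).
  by rewrite /base; case: pickP => // no; have [y] := recurrent_exists v; rewrite no.
by move/forallP/(_ v)/implyP/(_ (connect0 _ _))/fconnect_iterP => [t <-]; exists t.
Qed.

Definition depth (v : T) : nat := ex_minn (base_reached v).

Lemma iter_depth (v : T) : iter (depth v) g v = base v.
Proof. by rewrite /depth; case: ex_minnP => t /eqP. Qed.

Lemma depth_min (v : T) (t : nat) : iter t g v = base v -> depth v <= t.
Proof. by rewrite /depth; case: ex_minnP => s _ min /eqP/min. Qed.

Lemma depth_iter (v : T) (t : nat) : t <= depth v -> depth (iter t g v) = depth v - t.
Proof.
move=> td; apply/eqP; rewrite eqn_leq; apply/andP; split.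
  by apply: depth_min; rewrite -iterD subnK // base_iter iter_depth.
rewrite leq_subLR addnC; apply: depth_min.
by rewrite iterD iter_depth base_iter.
Qed.

(* Cutting the arcs leaving the vertices whose depth is congruent to [r] modulo
   [k] leaves only short walks, and an arc is cut for a single [r]. *)
Lemma functional_cut (k : nat) : 0 < k ->
  exists (h : T -> 'I_k) (rho : 'I_k -> T -> T),
    (forall r v, h v != r -> rho r v = rho r (g v)) /\
    forall r v, exists2 t, t <= 2 * k & rho r v = iter t g v.
Proof.
move=> k0; pose h v : 'I_k := Ordinal (ltn_pmod (depth v) k0).
(* [rho r v] will be the first vertex of residue [r] on the walk from [v], or the root if there is
   none. *)
pose ends r v := fun t => h (iter t g v) == r.
pose rho r v := if pselect (exists t, ends r v t) is left ex
  then iter (ex_minn ex) g v else base v.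
exists h, rho; split=> [r v hv|r v].
  rewrite /rho; case: pselect => [ex|nex]; case: pselect => [ex'|nex'].
  - case: ex_minnP => -[|t]; first by rewrite /ends /= (negPf hv).
    rewrite /ends iterSr => et tmin; case: ex_minnP => s es smin.
    congr (iter _ _ _); apply/eqP; rewrite eqn_leq smin //=.
    by rewrite -ltnS tmin // iterSr.
  - case: nex'; case: ex => -[|t]; first by rewrite /ends /= (negPf hv).
    by rewrite /ends iterSr => et; exists t.
  - by case: nex; case: ex' => t et; exists t.+1; rewrite /ends iterSr.
  - by rewrite base_step.
have deep w : k <= (depth w).+1 -> exists2 t, t < k & ends r w t.
  move=> kw;
  have rk := ltn_ord r.
  have main t q : t <= depth w -> depth w - t = q * k + r -> ends r w t.
    by move=> td E; rewrite /ends /h -val_eqE /= depth_iter // E modnMDl modn_small.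
  have := divn_eq (depth w) k; have := ltn_pmod (depth w) k0.
  move: (depth w %/ k) (depth w %% k) => q s sk dE.
  have [rs|sr] := leqP r s; first by exists (s - r); [lia|apply: (main _ q); lia].
  case: q dE => [|q] dE; first by lia.
  by exists (s + k - r); [lia|apply: (main _ q); lia].
rewrite /rho; case: pselect => [ex|nex]; last first.
  exists (depth v); last by rewrite iter_depth.
  case: (leqP k (depth v).+1) => [/deep[t _ et]|]; last by lia.
  by case: nex; exists t.
case: ex_minnP => t et tmin; exists t => //.
have [/deep[s sk /tmin]|dv] := leqP k (depth v).+1; first by lia.
(* Here [v] is close to the root, so the walk passes the root and goes on along the cycle from [u].
   Fewer than [k] steps up to [u] and fewer than [k] after it give the bound [2 * k]. *)
pose u := g (base v).
have iterE s : iter ((depth v).+1 + s) g v = iter s g u.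
  by rewrite addnC iterD iterS iter_depth.
have [/deep[s sk es]|du] := leqP k (depth u).+1.
  have /tmin : ends r v ((depth v).+1 + s) by rewrite /ends iterE.
  by lia.
(* The cycle is shorter than [k], so the first cut is met before going round it. *)
rewrite leqNgt; apply/negP => tbig.
have bu : base u = base v.
  by rewrite /u base_step -{1}(iter_depth v) base_iter.
have cyc s : iter ((depth v).+1 + (depth u).+1 + s) g v = iter ((depth v).+1 + s) g v.
  by rewrite -addnA !iterE [_.+1 + s]addnC iterD iterS iter_depth bu.
have tE : t = (depth v).+1 + (depth u).+1 + (t - (depth v).+1 - (depth u).+1) by lia.
have /tmin : ends r v ((depth v).+1 + (t - (depth v).+1 - (depth u).+1)).
  by rewrite /ends -cyc -tE.
by lia.
Qed.

(** A point that reaches [z] in at most [t.+1] steps is [z] itself or is mapped to a point that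
    reaches it in at most [t]. With [functional_cut] this bounds the size of the pieces. *)
Lemma card_iter_preim (a t : nat) (z : T) :
  (forall y, #|[set v | g v == y]| <= a) ->
  #|[set v | [exists i : 'I_t.+1, iter i g v == z]]| <= a.+1 ^ t.
Proof.
move=> ga; elim: t => [|t IH].
  rewrite expn0 -[leqRHS](cards1 z); apply/subset_leq_card/subsetP => v.
  by rewrite !inE => /existsP[[i i1] /=]; move: i1; rewrite ltnS leqn0 => /eqP->.
set S := [set v | _] in IH.
have card_pre : #|[set v | g v \in S]| <= a * #|S|.
  rewrite -sum1dep_card (partition_big g (mem S)) //= mulnC -sum_nat_const.
  apply: leq_sum => y yS; rewrite sum1dep_card; apply: leq_trans (ga y).
  by apply/subset_leq_card/subsetP => v; rewrite !inE => /andP[].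
have sub : [set v | [exists i : 'I_t.+2, iter i g v == z]] \subset
    z |: [set v | g v \in S].
  apply/subsetP => v; rewrite !inE => /existsP[[[|i] lt] /= iv]; first by rewrite iv.
  by apply/orP; right; apply/existsP; exists (Ordinal (lt : i < t.+1)); rewrite /= -iterSr iterS.
apply: leq_trans (subset_leq_card sub) _; apply: leq_trans (leq_card_setU _ _) _.
rewrite cards1 expnS mulSn; apply: leq_add; first by rewrite expn_gt0.
by apply: leq_trans card_pre _; rewrite leq_mul2l IH orbT.
Qed.

End FunctionalGraph.

(** * Contraction along labels *)

Section Contraction.
Variables (T : finType) (G : graph T).

Definition joined (X : finType) (p : T -> X) (x y : X) : bool :=
  [exists u, [exists v, [&& p u == x, p v == y & adj G u v]]].

Lemma joinedP (X : finType) (p : T -> X) (x y : X) :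
  reflect (exists u v, [/\ p u = x, p v = y & adj G u v]) (joined p x y).
Proof.
apply: (iffP existsP) => [[u /existsP[v /and3P[/eqP ux /eqP vy uv]]]|[u [v [ux vy uv]]]].
  by exists u, v.
by exists u; apply/existsP; exists v; rewrite ux vy uv !eqxx.
Qed.

(** Black neighbours count too, and so does the part itself if it contains an edge. This bounds red
    degrees without following the colours. *)
Definition parts_degree_le (w : nat) (X : finType) (p : T -> X) : Prop :=
  forall x, #|[set y | joined p x y]| <= w.

(* [H] is a trigraph whose vertices are the parts of the partition of the
   vertices of [G] into the fibers of [p]. *)
Definition quotient_by (H : trigraph) (p : T -> H) : Prop :=
  (forall x, exists u, p u = x) /\ forall x y, black x y || red x y -> joined p x y.

Lemma quotient_red_degree (w : nat) (H : trigraph) (p : T -> H) :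
  quotient_by p -> parts_degree_le w p -> red_degree_le w H.
Proof.
move=> [_ Hp] dp x; apply: leq_trans (dp x); apply/subset_leq_card/subsetP => y.
by rewrite !inE => xy; apply: Hp; rewrite xy orbT.
Qed.

Definition contract_map (H : trigraph) (u v : H) (x : H) : contract u v :=
  insub x.

Lemma contract_map_inj (H : trigraph) (u v x y : H) :
  contract_map u v x = contract_map u v y ->
  x = y \/ x \in [:: u; v] /\ y \in [:: u; v].
Proof.
rewrite /contract_map !inE; case: insubP => [a|]; case: insubP => [b|] //.
- by move=> _ <- _ <- [->]; left.
- by rewrite !negb_and !negbK => -> -> _; right.
Qed.

Lemma quotient_contract (H : trigraph) (u v : H) (p : T -> H) :
  quotient_by p -> quotient_by (contract_map u v \o p).
Proof.
move=> [onto Hp]; split=> [[a|]|x y].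
- by have [t ta] := onto (val a); exists t; rewrite /= /contract_map ta valK.
- have [t tu] := onto u; exists t; rewrite /= /contract_map tu insubN //.
  by rewrite eqxx.
have mono x' y' : black x' y' || red x' y' ->
    joined (contract_map u v \o p) (contract_map u v x') (contract_map u v y').
  move/Hp/joinedP => [t [t' [tx ty tt]]]; apply/joinedP; exists t, t'.
  by rewrite /= tx ty.
have mapS (a : {x : H | (x != u) && (x != v)}) : contract_map u v (val a) = Some a.
  by rewrite /contract_map valK.
have mapu : contract_map u v u = None by rewrite /contract_map insubN // eqxx.
have mapv : contract_map u v v = None by rewrite /contract_map insubN // eqxx andbF.
have toP (a : H) : to_black u v a || to_red u v a ->
    (black u a || red u a) || (black v a || red v a).
  rewrite /to_red /to_nonedge /to_black.
  by case: (black u a); case: (red u a); case: (black v a); case: (red v a).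
have symm (a b : H) : black a b || red a b -> black b a || red b a.
  by rewrite black_sym red_sym.
case: x y => [a|] [b|] //=.
- by move/mono; rewrite !mapS.
- by move/toP => /orP[] /symm/mono; rewrite ?mapS ?mapu ?mapv.
- by move/toP => /orP[] /mono; rewrite ?mapS ?mapu ?mapv.
Qed.

(** Parts with equal labels are contracted as long as there are any. Every partition met lies
    between the fibers of [p] and those of [lab], hence a degree bound for all such [p']; the last
    hypothesis takes over once the parts are the label classes. *)
Lemma merge_classes (w : nat) (C : eqType) (lab : T -> C) (H : trigraph) (p : T -> H) :
  quotient_by p ->
  (forall u v, p u = p v -> lab u = lab v) ->
  (forall (X : finType) (p' : T -> X),
     (forall u v, p u = p v -> p' u = p' v) ->
     (forall u v, p' u = p' v -> lab u = lab v) -> parts_degree_le w p') ->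
  (forall (H' : trigraph) (p' : T -> H'), quotient_by p' ->
     (forall u v, p' u = p' v <-> lab u = lab v) -> contraction_seq w H') ->
  contraction_seq w H.
Proof.
have [n] := ubnP #|H|; elim: n H p => // n IH H p; rewrite ltnS => Hn Hp plab deg last.
case: (pickP [pred uv : T * T | (p uv.1 != p uv.2) && (lab uv.1 == lab uv.2)]).
  move=> [u v] /= /andP[puv /eqP luv].
  apply: (contraction_seq_step puv).
    by apply: quotient_red_degree Hp _; apply: deg.
  apply: (IH _ (contract_map (p u) (p v) \o p)).
  - by move: Hn; rewrite -(card_contract puv).
  - exact: quotient_contract.
  - have labE t : p t \in [:: p u; p v] -> lab t = lab u.
      by rewrite !inE => /orP[] /eqP/plab->.
    by move=> t t' /contract_map_inj[/plab//|[/labE-> /labE->]].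
  - move=> X p' pp' p'lab; apply: deg => // t t' tt'; apply: pp'.
    by rewrite /= tt'.
  - exact: last.
move=> none; apply: (last _ p Hp) => u v; split=> [/plab//|luv].
by apply/eqP/negPn; have := none (u, v); rewrite /= luv eqxx andbT => ->.
Qed.

End Contraction.

Lemma card_agree (I : finType) (A : {set I}) (x : {ffun I -> bool}) :
  #|[set c : {ffun I -> bool} | [forall i in A, c i == x i]]| = 2 ^ #|~: A|.
Proof.
pose F i : pred bool := if i \in A then pred1 (x i) else predT.
transitivity #|family F|.
  apply: eq_card => c; rewrite inE; apply/forallP/familyP => cx i; have := cx i.
    by rewrite /F; case: ifP => //= _; rewrite inE.
  by rewrite /F; case: ifP => //= _; rewrite inE.
rewrite card_family foldrE big_image /= -prod_nat_const [RHS]big_mkcond /=.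
apply: eq_bigr => i _; rewrite /F inE; case: (i \in A) => /=; first by rewrite card1.
by rewrite card_bool.
Qed.

Lemma card_bigcup_le (I J : finType) (P : pred I) (B : I -> {set J}) (c : nat) :
  (forall i, P i -> #|B i| <= c) -> #|\bigcup_(i | P i) B i| <= #|P| * c.
Proof.
move=> Bc; apply: leq_trans (_ : \sum_(i | P i) #|B i| <= _).
  apply: (big_ind2 (fun (X : {set J}) k => #|X| <= k)) => //; first by rewrite cards0.
  by move=> X1 k1 X2 k2 ? ?; apply: leq_trans (leq_card_setU _ _) (leq_add _ _).
by rewrite -sum_nat_const; apply: leq_sum => i /Bc.
Qed.

(** While the label classes are formed, a part has at most [s] vertices, hence at most [s * Delta]
    neighbours. While the digit [l] is forgotten, an edge of code [q] leaves undetermined only the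
    digits outside [S q] and the digit [l]: at most [2 ^ m.+1] prefixes for each code. *)
Lemma tww_labelling (T : finType) (G : graph T) (L m s Delta : nat) (Q : finType)
    (Q0 : {set Q}) (b : 'I_L -> T -> bool) (S : Q -> {set 'I_L}) (code : T -> T -> Q) :
  0 < #|T| ->
  (forall u v, adj G u v -> code u v \in Q0) ->
  (forall u v, adj G u v -> forall i, i \in S (code u v) -> b i u = b i v) ->
  (forall q, q \in Q0 -> L <= m + #|S q|) ->
  (forall u, #|[set v | [forall i, b i u == b i v]]| <= s) ->
  (forall u, #|[set v | adj G u v]| <= Delta) ->
  tww G <= maxn (s * Delta) (#|Q0| * 2 ^ m.+1).
Proof.
move=> T0 codeQ agree Sm cls deg.
have [_ twmin] := twwP G T0; apply: twmin.
(* Digits from [l] on are blanked, so that prefixes of all lengths live in one type. *)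
pose lab l (u : T) := [ffun i : 'I_L => (i < l) && b i u].
set w := maxn _ _.
have labP l u v : lab l u = lab l v -> forall i : 'I_L, i < l -> b i u = b i v.
  by move=> /ffunP E i il; have := E i; rewrite !ffunE il.
have last l : l <= L -> forall (H : trigraph) (p : T -> H), quotient_by G p ->
    (forall u v, p u = p v <-> lab l u = lab l v) -> contraction_seq w H.
  elim: l => [_ H p Hp pl|l IH lL H p Hp pl].
    have H1 : #|H| = 1.
      have [u _] := card_gt0P T0.
      rewrite -cardsT -(cards1 (p u)); congr #|pred_of_set _|; apply/setP => x; rewrite !inE.
      have [t <-] := Hp.1 x; apply/esym/eqP/pl/ffunP => i; by rewrite !ffunE.
    apply: contraction_seq_point => // x; rewrite (_ : finset _ = set0) ?cards0 //.
    apply/setP => y; rewrite !inE; have [z zE] := mem_card1 H1.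
    have -> : x = y by have := zE x; have := zE y; rewrite !inE => /esym/eqP-> /esym/eqP->.
    by rewrite red_irrefl.
  apply: (@merge_classes _ G w _ (lab l) _ p Hp).
  - move=> u v /pl/labP uv; apply/ffunP => i; rewrite !ffunE.
    by case: (ltnP i l) => //= il; apply: uv; apply: ltnW.
  - move=> X p' pp' p'l x; apply: leq_trans (leq_maxr _ _).
    have [->|[y0]] := set_0Vmem [set y | joined G p' x y]; first by rewrite cards0.
    rewrite inE => /joinedP[u0 [v0 [u0x _ _]]].
    (* Positions at which [lab l.+1 v] must equal [lab l u0]: the kept digits below [l], and the
       blanked ones above [l]. *)
    pose A q := [set i in S q | i < l] :|: [set i : 'I_L | l < i].
    pose B := \bigcup_(q in Q0)
       [set c : {ffun 'I_L -> bool} | [forall i in A q, c i == lab l u0 i]].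
    have cB : #|B| <= #|Q0| * 2 ^ m.+1.
      apply: card_bigcup_le => q /Sm Sq; rewrite card_agree leq_exp2l //.
      have sub : ~: A q \subset Ordinal lL |: ~: S q.
        apply/subsetP => i; rewrite !inE -val_eqE /= => /norP[].
        by case: (i \in S q) => //= ??; lia.
      apply: leq_trans (subset_leq_card sub) _.
      apply: leq_trans (leq_card_setU _ _) _; rewrite cards1.
      by have := cardsC (S q); rewrite card_ord; lia.
    (* A part is a union of classes of [lab l.+1], so it is determined by the label of any of its
       vertices; [x] is only a default. *)
    pose f c := if [pick v | lab l.+1 v == c] is Some v then p' v else x.
    apply: leq_trans cB; apply: leq_trans (leq_imset_card f B).
    apply/subset_leq_card/subsetP => y; rewrite inE => /joinedP[u [v [ux vy uv]]].
    apply/imsetP; exists (lab l.+1 v).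
      apply/bigcupP; exists (code u v); first exact: codeQ.
      rewrite inE; apply/forallP => i; apply/implyP; rewrite !inE !ffunE.
      have /labP uu0 : lab l u = lab l u0 by apply: p'l; rewrite ux u0x.
      case/orP=> [/andP[iS il]|il]; last first.
        by have [-> ->] : (i < l.+1) = false /\ (i < l) = false by lia.
      rewrite il (ltn_trans il (ltnSn l)) /= -(uu0 _ il).
      by apply/eqP/esym/(agree _ _ uv).
    rewrite /f; case: pickP => [v' /eqP v'v|/(_ v)]; last by rewrite eqxx.
    by rewrite -vy; apply/esym/pp'/pl.
  - by apply: IH; apply: ltnW.
apply: (@merge_classes _ G w _ (lab L) (trigraph_of G) id).
- split=> [x|x y]; first by exists x.
  by rewrite /= orbF => xy; apply/joinedP; exists x, y.
- by move=> u v ->.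
- move=> X p' _ p'l x; apply: leq_trans (leq_maxl _ _).
  have [->|[y0]] := set_0Vmem [set y | joined G p' x y]; first by rewrite cards0.
  rewrite inE => /joinedP[u0 [v0 [u0x _ _]]].
  pose B := [set v | [forall i, b i u0 == b i v]].
  pose N := \bigcup_(u in B) [set v | adj G u v].
  have : #|p' @: N| <= s * Delta.
    apply: leq_trans (leq_imset_card _ _) _.
    by apply: leq_trans (card_bigcup_le (fun u _ => deg u)) _; rewrite leq_mul2r cls orbT.
  apply: leq_trans; apply/subset_leq_card/subsetP => y; rewrite inE.
  move=> /joinedP[u [v [ux vy uv]]]; apply/imsetP; exists v => //.
  apply/bigcupP; exists u; rewrite inE //; apply/forallP => i; apply/eqP.
  by apply: (labP L); rewrite ?ltn_ord //; apply: p'l; rewrite u0x.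
- exact: (last L (leqnn L)).
Qed.

(** * Digits, colours and residues *)

Lemma bin_le_expn (n k : nat) : 'C(n, k) <= n ^ k.
Proof.
apply: leq_trans (leq_pmulr _ (fact_gt0 k)) _; rewrite bin_ffact ffact_prod.
rewrite -[k in n ^ k]card_ord -prod_nat_const.
by apply: leq_prod => i _; apply: leq_subr.
Qed.

Lemma card_residue (J k r : nat) : 0 < k -> #|[set j : 'I_J | j %% k == r]| <= (J %/ k).+1.
Proof.
move=> k0.
have lt (j : 'I_J) : j %/ k < (J %/ k).+1 by rewrite ltnS leq_div2r // ltnW.
rewrite -(card_in_imset (f := fun j => Ordinal (lt j))).
  by rewrite -[leqRHS]card_ord max_card.
move=> i j; rewrite !inE => /eqP ir /eqP jr [ij].
by apply: val_inj; rewrite /= (divn_eq i k) (divn_eq j k) ir jr ij.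
Qed.

Section Digits.
Variables (L D k : nat).

(* The digit [i] uses the colour [i %% D] and cuts that colour at the residue
   [(i %/ D) %% k]; a set [c] of pairs (colour, residue) records an edge together
   with the residues at which it is cut in its colours. *)
Definition kept (c : {set 'I_D * 'I_k}) : {set 'I_L} :=
  [set i : 'I_L | [exists p in c, (p.1 == i %% D :> nat) && (p.2 != (i %/ D) %% k :> nat)]].

(** These are the graphs of the partial functions from colours to residues whose domain has size
    [k0]. *)
Definition codes (k0 : nat) : {set {set 'I_D * 'I_k}} :=
  [set c : {set 'I_D * 'I_k} | (#|c| == k0) &&
     [forall p in c, forall q in c, (p.1 == q.1) ==> (p == q)]].

Lemma card_codes (k0 : nat) : #|codes k0| <= (D * k) ^ k0.
Proof.
have -> : D * k = #|{: 'I_D * 'I_k}| by rewrite card_prod !card_ord.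
apply: leq_trans (bin_le_expn _ _); rewrite -card_draws.
by apply/subset_leq_card/subsetP => c; rewrite !inE => /andP[].
Qed.

(** With [J = L %/ D], the first [J * D] digits form [J] blocks in which each colour occurs once. A
    colour cut at residue [r] loses only the blocks congruent to [r] modulo [k], at most
    [J %/ k + 1] of them. *)
Lemma card_kept (k0 : nat) (c : {set 'I_D * 'I_k}) : 0 < D -> 0 < k -> c \in codes k0 ->
  k0 * (L %/ D - (L %/ D %/ k).+1) <= #|kept c|.
Proof.
move=> D0 k_gt0; rewrite inE => /andP[/eqP ck cinj]; set J := L %/ D.
have lt (p : 'I_D) (j : 'I_J) : j * D + p < L.
  have jJ : j.+1 * D <= J * D by rewrite leq_mul2r ltn_ord orbT.
  have := leq_divM L D; have := ltn_ord p; rewrite -/J.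
  by rewrite mulSn in jJ; lia.
pose f (x : ('I_D * 'I_k) * 'I_J) : 'I_L := Ordinal (lt x.1.1 x.2).
pose P := [set x : ('I_D * 'I_k) * 'I_J | (x.1 \in c) && (x.1.2 != x.2 %% k :> nat)].
have divf x : f x %/ D = x.2 by rewrite /= divnMDl // divn_small // addn0.
have modf x : f x %% D = x.1.1 by rewrite /= modnMDl modn_small.
have finj : {in P &, injective f}.
  move=> [p j] [q i]; rewrite !inE => /andP[/= pc _] /andP[/= qc _] E.
  have ij : j = i by apply: val_inj; rewrite -[LHS](divf (p, j)) E divf.
  have pq : p.1 = q.1 by apply: val_inj; rewrite -[LHS](modf (p, j)) E modf.
  move/forall_inP/(_ p pc)/forall_inP/(_ q qc)/implyP: cinj.
  by rewrite pq ij => /(_ (eqxx _))/eqP->.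
have sub : f @: P \subset kept c.
  apply/subsetP => _ /imsetP[x + ->]; rewrite !inE => /andP[xc xr].
  by apply/existsP; exists x.1; rewrite xc divf modf eqxx.
apply: leq_trans (subset_leq_card sub); rewrite card_in_imset // -ck.
have -> : #|P| = \sum_(p in c) #|[set j : 'I_J | p.2 != j %% k :> nat]|.
  under eq_bigr => p _ do rewrite -sum1dep_card.
  by rewrite pair_big_dep /= -sum1dep_card; apply: eq_bigl.
rewrite -sum_nat_const; apply: leq_sum => p _.
have := cardsC [set j : 'I_J | j %% k == p.2]; rewrite card_ord.
have := card_residue J p.2 k_gt0.
have -> : ~: [set j : 'I_J | j %% k == p.2] = [set j : 'I_J | p.2 != j %% k :> nat].
  by apply/setP => j; rewrite !inE eq_sym.
by lia.
Qed.

End Digits.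

(* The vertices are labelled by [L] bits, the [i]-th bit being constant on the
   fibers of a map [rho i] that identifies the ends of the kept edges. *)
Lemma tww_le (T : finType) (G : graph T) (k0 D k L s Delta : nat) :
  0 < #|T| -> 0 < k -> 0 < D -> k0 <= D ->
  (forall A : {set {set T}}, A \subset edges G -> k0 * #|A| <= D * #|cover A|) ->
  (forall u, #|[set v | adj G u v]| <= Delta) ->
  (forall rho : nat -> T -> T,
    (forall i z, #|[set v | rho i v == z]| <= Delta.+2 ^ (2 * k)) ->
    exists chi : nat -> T -> bool, forall u,
      #|[set v | [forall i : 'I_L, chi i (rho i u) == chi i (rho i v)]]| <= s) ->
  tww G <= maxn (s * Delta)
    ((D * k) ^ k0 * 2 ^ (L - k0 * (L %/ D - (L %/ D %/ k).+1)).+1).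
Proof.
move=> T0 k_gt0 D0 k0D dens deg colouring.
have [M [Minj Mend Mcount]] := edge_decomposition k0D dens.
(* The other end of the edge that [v] selects in colour [a]; a vertex that selects nothing is
   fixed. *)
pose g a v := if M a v is Some e then odflt v [pick u in e :\ v] else v.
have gE a v e : M a v = Some e -> e = [set v; g a v].
  move=> Me; have /andP[ve eG] := Mend _ _ _ Me.
  have := subsetP (edges_card2 G) _ eG; rewrite inE (cardsD1 v) ve eqSS => /cards1P[u uE].
  by rewrite /g Me uE; case: pickP => [w|/(_ u)]; rewrite !inE ?eqxx // => /eqP->;
     rewrite -uE setD1K.
(* Only [y] and its neighbours can be mapped to [y]; this gives the base [Delta.+2] of the fiber
   bound. *)
have g_fib a y : #|[set v | g a v == y]| <= Delta.+1.
  have sub : [set v | g a v == y] \subset y |: [set v | adj G y v].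
    apply/subsetP => v; rewrite !inE; case Me: (M a v) => [e|]; last by rewrite /g Me => ->.
    move/eqP=> <-; rewrite /adj setUC -(gE _ _ _ Me).
    by have /andP[_ ->] := Mend _ _ _ Me; rewrite orbT.
  apply: leq_trans (subset_leq_card sub) _; apply: leq_trans (leq_card_setU _ _) _.
  by rewrite cards1 add1n ltnS.
have [h hP] := choice (fun a => functional_cut (g a) k_gt0).
have [r rP] := choice hP.
pose col (i : nat) : 'I_D := Ordinal (ltn_pmod i D0).
pose res (i : nat) : 'I_k := Ordinal (ltn_pmod (i %/ D) k_gt0).
pose rho i := r (col i) (res i).
have [|chi cls] := colouring rho.
  move=> i z; apply: leq_trans (card_iter_preim (2 * k) z (g_fib (col i))).
  apply/subset_leq_card/subsetP => v; rewrite !inE => /eqP <-.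
  have [_ /(_ (res i) v)[t tk tE]] := rP (col i).
  by apply/existsP; exists (Ordinal (tk : t < (2 * k).+1)); rewrite /= -tE.
pose P e := [set p : 'I_D * T | M p.1 p.2 == Some e].
(* Each colour in which the edge is selected comes with the residue at which its arc is cut. *)
pose code u v : {set 'I_D * 'I_k} := [set (p.1, h p.1 p.2) | p in P [set u; v]].
apply: leq_trans (@tww_labelling T G L (L - k0 * (L %/ D - (L %/ D %/ k).+1)) s Delta _
  (codes D k k0) (fun i v => chi i (rho i v)) (@kept L D k) code T0 _ _ _ cls deg) _.
- move=> u v uv.
  have Pinj e p q : p \in P e -> q \in P e -> p.1 = q.1 -> p = q.
    case: p q => [a w] [a' w']; rewrite !inE /= => /eqP Me + aa'.
    by rewrite -aa' => /eqP Me'; rewrite (Minj _ _ _ _ Me Me').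
  rewrite inE; apply/andP; split.
    rewrite card_in_imset ?Mcount // => p q pP qP [pq _]; exact: Pinj pP qP pq.
  apply/forall_inP => p1 /imsetP[p pP ->]; apply/forall_inP => q1 /imsetP[q qP ->].
  by apply/implyP => /= /eqP pq; rewrite (Pinj _ _ _ pP qP pq).
- move=> u v uv i; rewrite inE => /existsP[x /and3P[/imsetP[[a w]]]].
  rewrite inE /= => /eqP Me -> /= /eqP ai /negPf hi.
  have aE : col i = a by apply: val_inj.
  (* The digit [i] uses a residue other than that of the arc, which is therefore not cut. *)
  have step : rho i w = rho i (g a w).
    have [/(_ (res i) w) + _] := rP (col i); rewrite /rho -aE; apply.
    by rewrite -val_eqE /= aE hi.
  have rhoE z : z \in [set u; v] -> rho i z = rho i w.
    by rewrite (gE _ _ _ Me) !inE => /orP[] /eqP-> //; rewrite step.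
  by rewrite !rhoE ?set21 ?set22.
- by move=> q; move/(card_kept L D0 k_gt0) => qS; lia.
by rewrite geq_max leq_maxl /= leq_max leq_mul2r card_codes !orbT.
Qed.

(** * Counting graphs with a vertex of large degree *)

Section UniformGraph.
Variable T : finType.
Let pairs : {set {set T}} := [set e : {set T} | #|e| == 2].

Lemma card_pairs : #|[set e : {set T} | #|e| == 2]| = 'C(#|T|, 2).
Proof. exact: card_draws. Qed.

Lemma card_graphs_edges (Q : pred {set {set T}}) :
  #|[set G : graph T | Q (edges G)]| =
  #|[set A : {set {set T}} | (A \subset [set e : {set T} | #|e| == 2]) && Q A]|.
Proof.
rewrite -(card_imset _ (@val_inj _ _ (graph T))); apply: eq_card => A; rewrite inE.
apply/imsetP/andP => [[G + ->]|[AP QA]]; first by rewrite inE /= (edges_card2 G).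
by exists (Graph AP); rewrite ?inE.
Qed.

Lemma card_graphs (m : nat) :
  #|[set G : graph T | #|edges G| == m]| = 'C('C(#|T|, 2), m).
Proof.
by rewrite (card_graphs_edges (fun A => #|A| == m)) cards_draws card_pairs.
Qed.

(** The quotient of the binomials is the product of the factors [(m - i) / (N - i)] for [i < t],
    each at most [m / N]. *)
Lemma bin_sub_le (N m t : nat) : t <= m <= N ->
  'C(N - t, m - t) * N ^ t <= m ^ t * 'C(N, m).
Proof.
move=> /andP[+ mN]; elim: t => [|t IH] tm; first by rewrite !subn0 muln1 mul1n.
apply: (@leq_trans (m * ('C(N - t, m - t) * N ^ t))); last first.
  by rewrite expnS -mulnA leq_mul2l IH ?orbT // ltnW.
rewrite expnS mulnA [X in _ <= X]mulnA; apply: leq_mul => //.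
have Nt : 0 < N - t by lia.
rewrite -(leq_pmul2l Nt) mulnA.
have -> : (N - t) * 'C(N - t.+1, m - t.+1) = (m - t) * 'C(N - t, m - t).
  have [-> ->] : N - t.+1 = (N - t).-1 /\ m - t.+1 = (m - t).-1 by lia.
  by rewrite mul_bin_diag prednK // subn_gt0.
rewrite mulnAC [X in _ <= X]mulnA; apply: leq_mul => //.
have [[NE mE] ba] : (N = t + (N - t) /\ m = t + (m - t)) /\ m - t <= N - t by lia.
rewrite [X in _ * X <= _]NE [X in _ <= _ * X]mE.
by move: (N - t) (m - t) ba => a b ba; nia.
Qed.

Lemma card_graphs_containing (S : {set {set T}}) (m t : nat) :
  S \subset [set e : {set T} | #|e| == 2] -> #|S| = t -> m <= 'C(#|T|, 2) ->
  #|[set G : graph T | (#|edges G| == m) && (S \subset edges G)]| * 'C(#|T|, 2) ^ t <=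
    m ^ t * #|[set G : graph T | #|edges G| == m]|.
Proof.
move=> SP St mN; rewrite card_graphs.
have [tm|mt] := leqP t m; last first.
  rewrite (_ : finset _ = set0) ?cards0 //; apply/setP => G; rewrite !inE.
  apply/negP => /andP[/eqP Gm /subset_leq_card]; rewrite St Gm; lia.
apply: leq_trans (bin_sub_le _); last by rewrite tm.
rewrite leq_mul2r; apply/orP; right.
rewrite (card_graphs_edges (fun A => (#|A| == m) && (S \subset A))).
rewrite -card_pairs -St -(cardsDS SP) -cards_draws.
pose minus (A : {set {set T}}) := A :\: S.
rewrite -(card_in_imset (f := minus)).
  apply/subset_leq_card/subsetP => _ /imsetP[A + ->]; rewrite !inE => /and3P[AP /eqP Am SA].
  by rewrite setSD // cardsDS // Am eqxx.
move=> A B; rewrite !inE => /and3P[_ _ SA] /and3P[_ _ SB] AB.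
by rewrite -(setID A S) -(setID B S) (setIidPr SA) (setIidPr SB) -/(minus A) AB.
Qed.

(** Union bound over the sets of [t] pairs in the star of [v]. *)
Lemma card_graphs_degree (v : T) (m t : nat) : m <= 'C(#|T|, 2) ->
  #|[set G : graph T | (#|edges G| == m) && (t <= #|[set u | adj G v u]|)]| *
    'C(#|T|, 2) ^ t <=
  'C(#|T|, t) * (m ^ t * #|[set G : graph T | #|edges G| == m]|).
Proof.
move=> mN.
pose star : {set {set T}} := [set [set v; u] | u in [set~ v]].
pose I := [set S : {set {set T}} | (S \subset star) && (#|S| == t)].
have starT : #|star| <= #|T| by apply: leq_trans (leq_imset_card _ _) (max_card _).
have starP : star \subset pairs.
  by apply/subsetP => _ /imsetP[u + ->]; rewrite !inE cards2 eq_sym => ->.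
have sub : [set G : graph T | (#|edges G| == m) && (t <= #|[set u | adj G v u]|)]
    \subset \bigcup_(S in I) [set G : graph T | (#|edges G| == m) && (S \subset edges G)].
  apply/subsetP => G; rewrite inE => /andP[Gm tG].
  pose N : {set {set T}} := [set [set v; u] | u in [set u | adj G v u]].
  have : t <= #|N|.
    rewrite card_in_imset // => x y; rewrite !inE => vx vy /setP/(_ x).
    rewrite !inE eqxx orbT => /esym/orP[/eqP xv|/eqP//].
    by move: vx; rewrite xv adj_irrefl.
  rewrite -bin_gt0 -cards_draws => /card_gt0P[S]; rewrite inE => /andP[SN St].
  have NG : N \subset edges G by apply/subsetP => _ /imsetP[u + ->]; rewrite inE.
  have Nstar : N \subset star.
    apply/subsetP => _ /imsetP[u + ->]; rewrite inE => vu; apply: imset_f.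
    by rewrite !inE; apply: contraTneq vu => ->; rewrite adj_irrefl.
  apply/bigcupP; exists S; last by rewrite inE Gm (subset_trans SN).
  by rewrite inE St (subset_trans SN).
apply: leq_trans (leq_mul (subset_leq_card sub) (leqnn _)) _.
set tot := #|[set G : graph T | #|edges G| == m]|.
have [->|N0] := posnP ('C(#|T|, 2) ^ t); first by rewrite muln0.
have IT : #|I| <= 'C(#|T|, t) by rewrite cards_draws leq_bin2l.
apply: leq_trans (leq_mul IT (leqnn (m ^ t * tot))).
apply: leq_trans (leq_mul (card_bigcup_le (c := (m ^ t * tot) %/ 'C(#|T|, 2) ^ t) _) (leqnn _)) _.
  move=> S; rewrite inE => /andP[Sstar /eqP St]; rewrite leq_divRL //.
  by apply: card_graphs_containing; rewrite ?(subset_trans Sstar).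
by rewrite -mulnA leq_mul2l leq_divM orbT.
Qed.

End UniformGraph.

From mathcomp Require Import all_order all_algebra.
From mathcomp Require Import all_classical all_reals all_analysis.
From mathcomp Require Import ring lra.
Import numFieldNormedType.Exports.
Import Order.TTheory GRing.Theory Num.Theory.

Local Open Scope classical_set_scope.
Local Open Scope ring_scope.

(** * Balanced random colourings *)

(** Applying [exp y <= 1 / (1 - y)] at [x] and at [- x] bounds the sum by [2 / (1 - x ^ 2)]. *)
Lemma cosh_le (R : realType) (x : R) : `|x| <= 1 / 2 ->
  expR x + expR (- x) <= 2 * expR (2 * x ^+ 2).
Proof.
move=> x2; have /andP[x2l x2r] : - (1 / 2) <= x <= 1 / 2 by rewrite -ler_norml.
have inv (y : R) : y <= 1 / 2 -> expR y <= (1 - y)^-1.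
  move=> y2; rewrite -[y in expR y]opprK expRN lef_pV2 ?posrE ?expR_gt0 //; last by lra.
  exact: expR_ge1Dx.
have h1 := inv x x2r.
have h2 : expR (- x) <= (1 - - x)^-1 by apply: inv; lra.
apply: le_trans (lerD h1 h2) _; apply: le_trans (_ : _ <= 2 * (1 + 2 * x ^+ 2)) _.
  have -> : (1 - x)^-1 + (1 - - x)^-1 = 2 / (1 - x ^+ 2).
    field; apply/and3P; split; apply/eqP; nra.
  rewrite ler_pdivrMr; last by nra.
  have y0 : 0 <= x ^+ 2 by exact: sqr_ge0.
  have y4 : x ^+ 2 <= 1 / 4 by nra.
  by move: (x ^+ 2) y0 y4 => y y0 y4; nra.
by rewrite ler_pM2l // expR_ge1Dx.
Qed.

(** Chernoff's bound for random signs on the fibers of [rho], of weight at most [K], with a union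
    bound over [u] and [b]. As [s] only bounds the class sizes from above, small classes do no
    harm. *)
Lemma split_classes (R : realType) (T : finType) (C : eqType) (c : T -> C)
    (rho : T -> T) (K : nat) (s eta : R) :
  (0 < K)%N -> (forall z, #|[set v | rho v == z]%SET| <= K)%N ->
  (forall u, #|[set v | c v == c u]%SET|%:R <= s) ->
  0 < eta <= 2 ->
  2 * #|T|%:R * expR (- (eta ^+ 2 * s / (8 * K%:R))) < 1 ->
  exists chi : T -> bool, forall u b,
    #|[set v | (c v == c u) && (chi (rho v) == b)]%SET|%:R <= s / 2 * (1 + eta).
Proof.
move=> K0 fib cls /andP[eta0 eta2] small.
have KR0 : 0 < K%:R :> R by rewrite ltr0n.
pose m u z : nat := #|[set v | (c v == c u) && (rho v == z)]%SET|.
pose sg (b b' : bool) : R := if b == b' then 1 else -1.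
(* This minimises [2 * lam ^ 2 * K * s - lam * eta * s], with minimum [- eta ^ 2 * s / (8 * K)], and
   keeps the arguments of [cosh_le] below 1/2. *)
pose lam := eta / (4 * K%:R).
have lam0 : 0 < lam by rewrite divr_gt0 ?mulr_gt0.
pose X u := [set v | c v == c u]%SET.
have mK u z : (m u z <= K)%N.
  by apply: leq_trans (fib z); apply/subset_leq_card/fintype.subsetP => v; rewrite !inE => /andP[].
have mX u : (\sum_z m u z = #|X u|)%N.
  rewrite /X -sum1dep_card [RHS](partition_big rho predT) //=.
  by apply: eq_bigr => z _; rewrite sum1dep_card.
have mXb u b (chi : T -> bool) :
    (\sum_(z | chi z == b) m u z)%N = #|[set v | (c v == c u) && (chi (rho v) == b)]%SET|.
  rewrite -sum1dep_card [RHS](partition_big rho (fun z => chi z == b)) => [|v /andP[]//].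
  apply: eq_bigr => z zb; rewrite sum1dep_card; apply: eq_card => v; rewrite !inE.
  by case: eqP => // _; case: eqP => [->|]; rewrite ?zb ?andbF.
have Xb u b (chi : T -> bool) :
    2 * #|[set v | (c v == c u) && (chi (rho v) == b)]%SET|%:R =
    #|X u|%:R + \sum_z (m u z)%:R * sg (chi z) b :> R.
  rewrite -mXb -mX !natr_sum big_mkcond mulr_sumr -big_split /=.
  by apply: eq_bigr => z _; rewrite /sg; case: eqP => _; ring.
pose phi u b (chi : {ffun T -> bool}) : R :=
  expR (lam * \sum_z (m u z)%:R * sg (chi z) b - lam * (eta * s)).
have mean u b : \sum_chi phi u b chi <=
    (2 ^ #|T|)%:R * expR (- (eta ^+ 2 * s / (8 * K%:R))).
  have -> : \sum_chi phi u b chi =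
      (\prod_(z : T) \sum_(b' : bool) expR (lam * ((m u z)%:R * sg b' b))) *
      expR (- (lam * (eta * s))).
    rewrite bigA_distr_bigA mulr_suml; apply: eq_bigr => chi _.
    by rewrite /phi expRD mulr_sumr expR_sum.
  have -> : expR (- (eta ^+ 2 * s / (8 * K%:R))) =
      expR (2 * lam ^+ 2 * (K%:R * s)) * expR (- (lam * (eta * s))).
    by rewrite -expRD; congr expR; rewrite /lam; field; rewrite gt_eqF.
  rewrite [leRHS]mulrA ler_pM2r ?expR_gt0 //.
  apply: le_trans (_ : \prod_(z : T) (2 * expR (2 * (lam * (m u z)%:R) ^+ 2)) <= _).
    apply: ler_prod => z _; rewrite big_bool /= addr_ge0 ?expR_ge0 //=.
    have : `|lam * (m u z)%:R| <= 1 / 2.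
      rewrite ger0_norm; last by rewrite mulr_ge0 // ltW.
      apply: le_trans (_ : lam * K%:R <= _).
        by rewrite ler_wpM2l ?ler_nat // ltW.
      have -> : lam * K%:R = eta / 4 by rewrite /lam; field; rewrite gt_eqF.
      by lra.
    move/cosh_le; rewrite /sg; case: b => /=; rewrite !mulr1 !mulrN1 !mulrN //.
    by rewrite addrC.
  rewrite big_split /= prodr_const -expR_sum natrX ler_pM2l ?exprn_gt0 // ler_expR.
  apply: le_trans (_ : \sum_z 2 * lam ^+ 2 * (K%:R * (m u z)%:R) <= _).
    apply: ler_sum => z _; rewrite exprMn [leLHS]mulrA.
    apply: ler_wpM2l; first by rewrite mulr_ge0 // sqr_ge0.
    by rewrite expr2; apply: ler_wpM2r; rewrite ?ler_nat.
  rewrite -!mulr_sumr -natr_sum mX; apply: ler_wpM2l; first by rewrite mulr_ge0 // sqr_ge0.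
  by apply: ler_wpM2l; rewrite ?cls.
case: (pselect (exists chi : {ffun T -> bool}, forall u b,
    \sum_z (m u z)%:R * sg (chi z) b <= eta * s)) => [[chi good]|none].
  exists chi => u b; have := good u b; have := cls u; have := Xb u b chi.
  by rewrite /X; nra.
exfalso.
(* If every colouring fails somewhere, each contributes at least 1, whereas the sum of all [phi] is
   less than the number of colourings. *)
have : (2 ^ #|T|)%:R <= \sum_(chi : {ffun T -> bool}) \sum_u \sum_b phi u b chi :> R.
  have -> : (2 ^ #|T|)%:R = \sum_(chi : {ffun T -> bool}) 1 :> R.
    by rewrite sumr_const card_ffun card_bool.
  apply: ler_sum => chi _.
  have [u [b bad]] : exists u b, eta * s < \sum_z (m u z)%:R * sg (chi z) b.
    apply: contrapT => no; apply: none; exists chi => u b.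
    by rewrite leNgt; apply/negP => bad; apply: no; exists u, b.
  have phi_ge1 : 1 <= phi u b chi.
    by rewrite -expR0 ler_expR -mulrBr mulr_ge0 ?subr_ge0 // ltW.
  rewrite (bigD1 u) //= (bigD1 b) //= -addrA; apply: le_trans phi_ge1 _.
  rewrite lerDl addr_ge0 //; first by apply: sumr_ge0 => *; exact: expR_ge0.
  by apply: sumr_ge0 => u' _; apply: sumr_ge0 => *; exact: expR_ge0.
rewrite exchange_big /=; under eq_bigr => u _ do rewrite exchange_big /=.
apply/negP; rewrite -ltNge.
apply: le_lt_trans (_ : \sum_(u : T) \sum_(b : bool) (2 ^ #|T|)%:R *
  expR (- (eta ^+ 2 * s / (8 * K%:R))) < _).
  apply: ler_sum => u _; rewrite [leLHS](_ : _ = \sum_(b : bool) \sum_chi phi u b chi) //.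
  by apply: ler_sum => b _; apply: mean.
have pos : 0 < (2 ^ #|T|)%:R :> R by rewrite ltr0n expn_gt0.
have [P PE] : {P : R | P = (2 ^ #|T|)%:R} by exists (2 ^ #|T|)%:R.
rewrite !sumr_const card_bool -!PE in pos *.
move: (expR _) small => e small.
have -> : P * e *+ 2 *+ #|T| = P * (2 * #|T|%:R * e).
  by rewrite -[LHS]mulr_natr -[_ *+ 2]mulr_natr; ring.
by rewrite gtr_pMr.
Qed.

(** The classes are split digit by digit. The size allowed at stage [l] is never below
    [#|T| / 2 ^ L], so a single smallness hypothesis serves all stages. *)
Lemma balanced_colouring (R : realType) (T : finType) (rho : nat -> T -> T)
    (K L : nat) (eta : R) :
  (0 < K)%N -> (forall i z, #|[set v | rho i v == z]%SET| <= K)%N ->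
  0 < eta <= 2 ->
  2 * #|T|%:R * expR (- (eta ^+ 2 * (#|T|%:R / 2 ^+ L) / (8 * K%:R))) < 1 ->
  exists chi : nat -> T -> bool, forall u,
    #|[set v | [forall i : 'I_L, chi i (rho i u) == chi i (rho i v)]]%SET|%:R <=
    #|T|%:R * ((1 + eta) / 2) ^+ L.
Proof.
move=> K0 fib eta02 small; have /andP[eta0 eta2] := eta02.
suff H l : (l <= L)%N -> exists chi : nat -> T -> bool, forall u,
    #|[set v | [forall i : 'I_l, chi i (rho i u) == chi i (rho i v)]]%SET|%:R <=
    #|T|%:R * ((1 + eta) / 2) ^+ l by exact: (H L (leqnn L)).
elim: l => [_|l IH lL].
  by exists (fun _ _ => true) => u; rewrite expr0 mulr1 ler_nat max_card.
have [chi Hchi] := IH (ltnW lL).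
pose c v := [ffun i : 'I_l => chi i (rho i v)].
have cE u v : (c v == c u) = [forall i : 'I_l, chi i (rho i u) == chi i (rho i v)].
  apply/eqP/forallP => [/ffunP E i|E]; first by have := E i; rewrite !ffunE => ->.
  by apply/ffunP => i; rewrite !ffunE; apply/esym/eqP.
have cls u : #|[set v | c v == c u]%SET|%:R <= #|T|%:R * ((1 + eta) / 2) ^+ l :> R.
  by under eq_finset => v do rewrite cE; apply: Hchi.
have small' : 2 * #|T|%:R *
    expR (- (eta ^+ 2 * (#|T|%:R * ((1 + eta) / 2) ^+ l) / (8 * K%:R))) < 1 :> R.
  apply: le_lt_trans small; apply: ler_wpM2l; first by rewrite mulr_ge0.
  rewrite ler_expR lerN2; apply: ler_wpM2r; first by rewrite invr_ge0 mulr_ge0.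
  apply: ler_wpM2l; first exact: sqr_ge0.
  apply: ler_wpM2l; rewrite // -exprVn; apply: le_trans (_ : 2^-1 ^+ l <= _).
    by apply: ler_wiXn2l; [lra|lra|exact: ltnW].
  by apply: lerXn2r; rewrite ?nnegrE; lra.
have [new Hnew] := split_classes K0 (fib l) cls eta02 small'.
exists (fun i z => if i == l then new z else chi i z) => u.
apply: le_trans (_ : #|[set v | (c v == c u) && (new (rho l v) == new (rho l u))]%SET|%:R <= _).
  rewrite ler_nat; apply/subset_leq_card/fintype.subsetP => v; rewrite !inE cE.
  move/forallP => E; apply/andP; split; last by have := E ord_max; rewrite /= eqxx eq_sym.
  apply/forallP => i; have := E (widen_ord (leqnSn l) i).
  by rewrite /= ltn_eqF ?ltn_ord.
by apply: le_trans (Hnew u _) _; rewrite exprSr; lra.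
Qed.

(** * Choice of the parameters *)

Lemma ln2_ge (R : realType) : 1 / 2 <= ln 2 :> R.
Proof.
rewrite -[leLHS]expRK ler_ln ?posrE ?expR_gt0 //.
have : expR (- (1 / 2)) >= 1 / 2 :> R by apply: le_trans (expR_ge1Dx _); lra.
rewrite expRN; have := expR_gt0 (1 / 2 : R); move: (expR _) => x x0 xV.
have xx : x * x^-1 = 1 by rewrite divff ?gt_eqF.
by nra.
Qed.

Lemma ln2_le (R : realType) : ln 2 <= 1 :> R.
Proof.
have e : 1 + 1 = 2 :> R by ring.
by have := @le_ln1Dx R 1; rewrite e; apply; lra.
Qed.

(* The logarithm of the allowed loss, up to a constant factor. *)
Definition budget (R : realType) (Lam d : R) : R := d^-1 * Num.sqrt Lam * ln Lam + ln d.

(** The first summand controls [ln Lam] if [d <= sqrt Lam], and [ln d] does so otherwise. For the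
    last bound [d] is compared with [Lam], beyond which [sqrt Lam / d] is at most 1. *)
Lemma budget_bounds (R : realType) (Lam d : R) : 1 <= Lam -> 2 <= d ->
  [/\ 1 / 2 <= budget Lam d, ln d <= budget Lam d, ln Lam <= 2 * budget Lam d,
      Num.sqrt Lam / d * ln Lam <= budget Lam d &
      Num.sqrt Lam / d * ln d <= budget Lam d].
Proof.
move=> Lam1 d2; have [d0 Lam0] : 0 < d /\ 0 < Lam by split; lra.
have lnLam : 0 <= ln Lam by exact: ln_ge0.
have ln2d : ln 2 <= ln d by rewrite ler_ln ?posrE.
have ln2 := @ln2_ge R.
set q := Num.sqrt Lam / d; have q0 : 0 <= q by rewrite divr_ge0 ?sqrtr_ge0 ?ltW.
have YE : budget Lam d = q * ln Lam + ln d by rewrite /budget /q; ring.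
have p0 : 0 <= q * ln Lam by rewrite mulr_ge0.
have s0 : 0 < Num.sqrt Lam by rewrite sqrtr_gt0.
split; rewrite YE; try lra.
  have [dq|qd] := leP d (Num.sqrt Lam).
    have : 1 <= q by rewrite ler_pdivlMr ?mul1r.
    by nra.
  have : ln (Num.sqrt Lam) <= ln d by rewrite ler_ln ?posrE // ltW.
  by rewrite -powR12_sqrt ?(ltW Lam0) // ln_powR; lra.
have [dL|Ld] := leP d Lam.
  have : q * ln d <= q * ln Lam by apply: ler_wpM2l => //; rewrite ler_ln ?posrE.
  by lra.
have s1 : Num.sqrt Lam <= Lam.
  have s1 : 1 <= Num.sqrt Lam by rewrite -sqrtr1 ler_wsqrtr.
  by rewrite -[leRHS]sqr_sqrtr ?(ltW Lam0) // expr2; nra.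
have q1 : q <= 1 by rewrite ler_pdivrMr // mul1r; lra.
by nra.
Qed.

(** The ideal number of lost digits is [L * (1 - 2 / d)]. The other terms come from rounding [D] up,
    from the cuts, and from the integer divisions. *)
Lemma digit_loss (R : realType) (L D k k0 : nat) (d : R) :
  2 <= d -> (0 < k)%N -> (0 < k0 <= D)%N ->
  k0%:R * d / 2 <= D%:R <= k0%:R * d / 2 + 1 ->
  (L - k0 * (L %/ D - (L %/ D %/ k).+1))%:R <=
    L%:R * (1 - 2 / d) + 4 * L%:R / (k0%:R * d ^+ 2) + 2 * L%:R / (d * k%:R) +
    2 * k0%:R.
Proof.
move=> d2 k_gt0 /andP[k0_gt0 k0D] /andP[Dl Dr].
set J := (L %/ D)%N; set x := (k0 * _)%N.
have JDL : (J * D <= L)%N by exact: leq_divM.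
have xL : (x <= L)%N.
  apply: leq_trans JDL; rewrite /x mulnC; apply: leq_mul => //; exact: leq_subr.
have D0 : (0 < D)%N by apply: leq_trans k0_gt0 k0D.
have LJ : (L <= J.+1 * D)%N by apply/ltnW/ltn_ceil.
have [dR kR k0R DR] : [/\ 0 < d, 0 < k%:R :> R, 0 < k0%:R :> R & 0 < D%:R :> R].
  by split; rewrite ?ltr0n //; lra.
rewrite natrB //.
have xR : k0%:R * (J%:R - J%:R / k%:R - 1) <= x%:R :> R.
  rewrite /x natrM; apply: ler_wpM2l; first exact: ltW.
  rewrite -addrA -opprD lerBlDr.
  have : J%:R <= (J - (J %/ k).+1)%:R + (J %/ k).+1%:R :> R by rewrite -natrD ler_nat; lia.
  have : (J %/ k)%:R <= J%:R / k%:R :> R.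
    by rewrite ler_pdivlMr // -natrM ler_nat leq_divM.
  by rewrite -[(J %/ k).+1]addn1 natrD; lra.
have JR : L%:R / D%:R - 1 <= J%:R :> R.
  by rewrite lerBlDr ler_pdivrMr // -[1]/(1%:R) -natrD addn1 -natrM ler_nat.
(* [t] is the fraction of the colours in which an edge is selected, and [e] its ideal value. *)
pose t : R := k0%:R / D%:R; pose e : R := 2 / d; pose i : R := k%:R^-1.
have [i0 i1] : 0 <= i /\ i <= 1.
  by rewrite invr_ge0 ltW // invf_le1 // ler1n.
have e0 : 0 < e by rewrite divr_gt0.
have te : t <= e.
  rewrite ler_pdivrMr // /e mulrAC ler_pdivlMr //; lra.
have et : e - e ^+ 2 / k0%:R <= t.
  rewrite ler_pdivlMr //.
  have c0 : 0 <= e - e ^+ 2 / k0%:R.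
    rewrite subr_ge0 ler_pdivrMr // expr2; apply: ler_wpM2l; first exact: ltW.
    apply: le_trans (_ : 1 <= _); last by rewrite ler1n.
    by rewrite ler_pdivrMr //; lra.
  have DE : D%:R <= k0%:R / e + 1.
    by apply: le_trans Dr _; rewrite /e invf_div mulrA.
  apply: le_trans (ler_wpM2l c0 DE) _.
  have -> : (e - e ^+ 2 / k0%:R) * (k0%:R / e + 1) = k0%:R - e ^+ 2 / k0%:R.
    by field; apply/andP; split; apply: lt0r_neq0.
  by rewrite gerBl divr_ge0 ?sqr_ge0 ?ltW.
have L0 : 0 <= L%:R :> R by [].
have main : L%:R * t * (1 - i) - 2 * k0%:R <= x%:R :> R.
  apply: le_trans xR.
  have -> : L%:R * t * (1 - i) - 2 * k0%:R = k0%:R * (L%:R / D%:R * (1 - i) - 2).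
    by rewrite /t; field; apply: lt0r_neq0.
  apply: ler_wpM2l; first exact: ltW.
  rewrite -/i; nra.
have -> : 4 * L%:R / (k0%:R * d ^+ 2) = L%:R * (e ^+ 2 / k0%:R) :> R.
  by rewrite /e; field; apply/andP; split; apply: lt0r_neq0.
have -> : 2 * L%:R / (d * k%:R) = L%:R * e * i :> R.
  by rewrite /e /i; field; apply/andP; split; apply: lt0r_neq0.
have h1 : L%:R * t * i <= L%:R * e * i.
  by apply: ler_wpM2r => //; apply: ler_wpM2l.
have h2 : L%:R * (e - e ^+ 2 / k0%:R) <= L%:R * t by apply: ler_wpM2l.
by rewrite -/e; lra.
Qed.

Lemma tww_le_card (T : finType) (G : graph T) : (0 < #|T|)%N -> (tww G <= #|T|)%N.
Proof.
move=> T0; have [_] := twwP G T0; apply; apply: contraction_seq_exists.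
by rewrite T0 /=.
Qed.

Lemma tww_boundE (R : realType) (C d : R) (n : nat) : (0 < n)%N ->
  tww_bound C n d =
  expR ((d - 2) / (2 * d - 2) * ln n%:R + C * budget (ln n%:R) d).
Proof. by move=> n0; rewrite /tww_bound /powR pnatr_eq0 gtn_eqF // expRD. Qed.

Lemma natrX2E (R : realType) (m : nat) : 2 ^+ m = expR (m%:R * ln 2) :> R.
Proof. by rewrite expRM_natl lnK ?posrE. Qed.

(** Since [d + Lam <= 2 * (d * Lam)], the logarithm splits into [ln d + ln Lam] and a constant,
    absorbed because [budget] is at least 1/2. *)
Lemma ln_degree (R : realType) (B Lam d : R) (Delta : nat) :
  1 <= B -> 1 <= Lam -> 2 <= d -> Delta%:R <= B * (d + Lam) ->
  ln (Delta%:R + 2) <= (2 * ln (4 * B) + 3) * budget Lam d.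
Proof.
move=> B1 Lam1 d2 deg; have [Y2 Yd YL _ _] := budget_bounds Lam1 d2.
have dL : 2 <= d * Lam by nra.
have le : Delta%:R + 2 <= 4 * B * (d * Lam).
  have : d + Lam <= 2 * (d * Lam) by nra.
  by nra.
have D0 : 0 < Delta%:R + 2 :> R by rewrite ltr_wpDl.
have : ln (Delta%:R + 2) <= ln (4 * B * (d * Lam)) by rewrite ler_ln ?posrE //; nra.
rewrite lnM ?posrE; [|lra|lra]; rewrite [ln (d * _)]lnM ?posrE; [|lra|lra].
have lB : 0 <= ln (4 * B) by apply: ln_ge0; lra.
have : 0 <= ln (4 * B) * (budget Lam d - 1 / 2) by rewrite mulr_ge0 // subr_ge0.
by lra.
Qed.

(* A power of [n] beats the number [2 n] of events and the factor [L ^+ 2]. *)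
Lemma colouring_condition (R : realType) (n L K : nat) (c0 : R) :
  (0 < n)%N -> (0 < L)%N -> (0 < K)%N -> 0 < c0 ->
  let Lam : R := ln n%:R in let c : R := (3 / 4 * c0) ^+ 4 / 768 in
  2 / c + 2 <= Lam -> L%:R <= 2 * Lam ->
  expR (c0 * Lam) <= n%:R / 2 ^+ L -> K%:R <= expR (c0 * Lam / 4) ->
  2 * n%:R * expR (- (L%:R^-1 ^+ 2 * (n%:R / 2 ^+ L) / (8 * K%:R))) < 1 :> R.
Proof.
move=> n_gt0 L_gt0 K_gt0 c00 Lam c big L2 nL KE.
have c_gt0 : 0 < c by apply: divr_gt0; [apply: exprn_gt0|]; lra.
have ic0 : 0 < 2 / c by rewrite divr_gt0.
have cLam : 2 < c * Lam.
  have : c * (2 / c + 2) <= c * Lam by rewrite ler_pM2l.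
  have -> : c * (2 / c + 2) = 2 + 2 * c by field; apply: lt0r_neq0.
  by lra.
have nE : 2 * n%:R = expR (ln 2 + Lam) :> R.
  by rewrite expRD !lnK ?posrE ?ltr0n.
rewrite nE -expRD expR_lt1; set X := _ / (8 * _).
suff : ln 2 + Lam < X by lra.
have L0 : 0 < L%:R :> R by rewrite ltr0n.
have K0 : 0 < K%:R :> R by rewrite ltr0n.
have XE : X = n%:R / 2 ^+ L / (8 * L%:R ^+ 2 * K%:R).
  by rewrite /X; field; rewrite !lt0r_neq0 ?exprn_gt0.
(* The term of degree 4 of the exponential series. Dividing it by [8 * L ^ 2 <= 32 * Lam ^ 2] leaves
   [c * Lam ^ 2], with [768 = 24 * 32]. *)
have e34 : (3 / 4 * c0 * Lam) ^+ 4 / 24 <= expR (3 / 4 * c0 * Lam).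
  have := @expR_ge1Dxn R (3 / 4 * c0 * Lam) 3.
  rewrite (_ : 4`! = 24)%N // => h; apply: le_trans (_ : _ <= 1 + _) (h _).
    by rewrite lerDr.
  by rewrite !mulr_ge0 ?divr_ge0 //; lra.
have Lam0 : 0 < Lam by lra.
have step : c * Lam ^+ 2 <= X.
  rewrite XE ler_pdivlMr; last by rewrite !mulr_gt0 // exprn_gt0.
  apply: le_trans nL; have -> : c0 * Lam = 3 / 4 * c0 * Lam + c0 * Lam / 4 by field.
  rewrite expRD.
  apply: le_trans (_ : (3 / 4 * c0 * Lam) ^+ 4 / 24 * K%:R <= _); last first.
    apply: ler_pM => //; by rewrite divr_ge0 // exprn_even_ge0.
  rewrite mulrA; apply: ler_wpM2r; first exact: ltW.
  have -> : (3 / 4 * c0 * Lam) ^+ 4 / 24 = c * Lam ^+ 2 * (8 * (2 * Lam) ^+ 2).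
    by rewrite /c; field.
  apply: ler_wpM2l; first by rewrite mulr_ge0 ?sqr_ge0 // ltW.
  by apply: ler_wpM2l => //; apply: lerXn2r; rewrite ?nnegrE; lra.
have := @ln2_le R; have : 2 * Lam < c * Lam ^+ 2 by rewrite expr2 mulrA ltr_pM2r.
by lra.
Qed.

(* The logarithm of the number of codes times [2 ^ m.+1]. *)
Lemma code_exponent (R : realType) (Lam d a P c0 : R) (L D k k0 : nat) :
  2 <= Lam -> 2 <= d -> (0 < k)%N -> (0 < k0)%N -> (k0 <= D)%N ->
  Num.sqrt Lam / d <= k0%:R -> k0%:R <= Num.sqrt Lam / d + 1 ->
  k0%:R * d / 2 <= D%:R <= k0%:R * d / 2 + 1 ->
  0 < c0 -> c0 <= 1 -> 1 / 2 <= a ->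
  k%:R * a <= c0 / 8 * Lam -> c0 / 8 * Lam <= 2 * k%:R * a -> a <= P * budget Lam d ->
  L%:R * ln 2 <= d / (2 * d - 2) * Lam ->
  k0%:R * ln (D * k)%:R +
    (L - k0 * (L %/ D - (L %/ D %/ k).+1)).+1%:R * ln 2 <=
  (d - 2) / (2 * d - 2) * Lam + 26 * budget Lam d + 16 * (P * budget Lam d / c0).
Proof.
move=> Lam2 d2 k_gt0 k0_gt0 k0D k01 k02 D1 c00 c01 a2 k1 k2 aP L1.
have Lam1 : 1 <= Lam by lra.
have [Y2 Yd YL YqL Yqd] := budget_bounds Lam1 d2.
set Y := budget Lam d in aP Y2 Yd YL YqL Yqd *.
have d0 : 0 < d by lra.
have Lam0 : 0 < Lam by lra.
have l2 := @ln2_ge R; have l2' := @ln2_le R.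
have D0 : (0 < D)%N by apply: leq_trans k0_gt0 k0D.
have s0 : 0 < Num.sqrt Lam by rewrite sqrtr_gt0.
have ss : Num.sqrt Lam * Num.sqrt Lam = Lam by rewrite -expr2 sqr_sqrtr // ltW.
have s1 : Num.sqrt Lam <= Lam.
  have : 1 <= Num.sqrt Lam by rewrite -sqrtr1 ler_wsqrtr.
  by nra.
have kR : 0 < k%:R :> R by rewrite ltr0n.
have k0R : 0 < k0%:R :> R by rewrite ltr0n.
have qd : Num.sqrt Lam / d * d = Num.sqrt Lam by rewrite divfK // lt0r_neq0.
have q0 : 0 <= Num.sqrt Lam / d by rewrite divr_ge0 // ltW.
move: (Num.sqrt Lam / d) q0 k01 k02 YqL Yqd qd => q q0 k01 k02 YqL Yqd qd.
have kLam : k%:R <= Lam.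
  have : k%:R * (1 / 2) <= k%:R * a by apply: ler_wpM2l => //; exact: ltW.
  by nra.
have DLam : D%:R <= d * Lam.
  have : k0%:R * d <= Num.sqrt Lam + d.
    by rewrite -qd -[X in _ + X]mul1r -mulrDl; apply: ler_wpM2r => //; exact: ltW.
  have : d * 2 <= d * Lam by apply: ler_wpM2l => //; exact: ltW.
  have : 2 * Lam <= d * Lam by apply: ler_wpM2r => //; exact: ltW.
  by case/andP: D1 => _; lra.
have lnLam : 0 <= ln Lam by exact: ln_ge0.
have lnd : 1 / 2 <= ln d by apply: le_trans l2 _; rewrite ler_ln ?posrE.
have q2Y : q <= 2 * Y by nra.
have lnDk : ln (D * k)%:R <= ln d + 2 * ln Lam.
  apply: le_trans (_ : ln (d * Lam * Lam) <= _).
    rewrite ler_ln ?posrE ?ltr0n ?muln_gt0 ?D0 // ?mulr_gt0 // natrM.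
    by apply: ler_pM.
  by rewrite !lnM ?posrE ?mulr_gt0 //; lra.
have h1 : k0%:R * ln (D * k)%:R <= 8 * Y.
  apply: le_trans (_ : (q + 1) * (ln d + 2 * ln Lam) <= _); last by lra.
  apply: le_trans (_ : k0%:R * (ln d + 2 * ln Lam) <= _).
    by apply: ler_wpM2l => //; exact: ltW.
  by apply: ler_wpM2r => //; lra.
have k0D' : (0 < k0 <= D)%N by rewrite k0_gt0.
have := @digit_loss R L D k k0 d d2 k_gt0 k0D' D1.
set m := (L - _)%N => loss.
have dd : 0 < 2 * d - 2 by lra.
have alphaE : d / (2 * d - 2) * Lam * (1 - 2 / d) = (d - 2) / (2 * d - 2) * Lam.
  by field; rewrite !lt0r_neq0.
have betaLam : d / (2 * d - 2) * Lam <= Lam.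
  by rewrite -[leRHS]mul1r; apply: ler_wpM2r; [exact: ltW|rewrite ler_pdivrMr //; lra].
have L_ge0 : 0 <= L%:R * ln 2 :> R by rewrite mulr_ge0 //; lra.
have t1 : L%:R * (1 - 2 / d) * ln 2 <= (d - 2) / (2 * d - 2) * Lam.
  rewrite -alphaE mulrAC; apply: ler_wpM2r => //.
  by rewrite subr_ge0 ler_pdivrMr // mul1r.
(* The loss from rounding [D]. Since [k0 >= q] and [q ^ 2 * d ^ 2 = Lam], it is at most [4 * q]. *)
have t2 : 4 * L%:R / (k0%:R * d ^+ 2) * ln 2 <= 8 * Y.
  apply: le_trans (_ : 4 * q <= _); last by lra.
  have -> : 4 * L%:R / (k0%:R * d ^+ 2) * ln 2 = 4 * (L%:R * ln 2) / (k0%:R * d ^+ 2).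
    by field; rewrite !lt0r_neq0.
  rewrite ler_pdivrMr; last by rewrite mulr_gt0 // exprn_gt0.
  have : q * (q * d ^+ 2) <= q * (k0%:R * d ^+ 2).
    by apply: ler_wpM2l => //; apply: ler_wpM2r => //; exact: sqr_ge0.
  have : q * (q * d ^+ 2) = Lam by rewrite -ss -qd; ring.
  by lra.
(* The loss from the cuts: [c0 / 8 * Lam <= 2 * k * a] and [a <= P * Y] bound [1 / k] by
   [16 * P * Y / (c0 * Lam)]. *)
have t3 : 2 * L%:R / (d * k%:R) * ln 2 <= 16 * (P * Y / c0).
  have -> : 2 * L%:R / (d * k%:R) * ln 2 = 2 * (L%:R * ln 2) / (d * k%:R).
    by field; rewrite !lt0r_neq0.
  rewrite ler_pdivrMr ?mulr_gt0 //.
  have : Lam <= 16 * k%:R * (P * Y / c0).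
    rewrite mulrA ler_pdivlMr // mulrC.
    have : k%:R * a <= k%:R * (P * Y) by apply: ler_wpM2l => //; exact: ltW.
    by lra.
  move/(ler_wpM2l (ltW d0)); have : 2 * Lam <= d * Lam by apply: ler_wpM2r => //; exact: ltW.
  by lra.
have t4 : 2 * k0%:R * ln 2 <= 8 * Y.
  have : k0%:R * ln 2 <= k0%:R * 1 :> R by apply: ler_wpM2l => //; exact: ltW.
  by lra.
have tm : m%:R * ln 2 <= L%:R * (1 - 2 / d) * ln 2 +
    4 * L%:R / (k0%:R * d ^+ 2) * ln 2 + 2 * L%:R / (d * k%:R) * ln 2 +
    2 * k0%:R * ln 2.
  by rewrite -!mulrDl; apply: ler_wpM2r => //; apply: le_trans l2; lra.
have -> : m.+1%:R * ln 2 = m%:R * ln 2 + ln 2 :> R by rewrite -[m.+1%:R]natr1 mulrDl mul1r.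
move: (k0%:R * ln _) (_ * ln 2) (_ * ln 2) (_ * ln 2) (_ * ln 2) (_ * ln 2)
  h1 t1 t2 t3 t4 tm => x1 x2 x3 x4 x5 x6 h1 t1 t2 t3 t4 tm.
by clear - h1 t1 t2 t3 t4 tm l2' Y2; lra.
Qed.

(** With relative error [1 / L] per digit, all [L] halvings together lose only a constant factor. *)
Lemma compound_halving (R : realType) (x : R) (L : nat) : 0 <= x -> (0 < L)%N ->
  x * ((1 + L%:R^-1) / 2) ^+ L <= x / 2 ^+ L * expR 1.
Proof.
move=> x0 L_gt0; have L0 : 0 < L%:R :> R by rewrite ltr0n.
rewrite exprMn exprVn mulrA [x * _ / _]mulrAC; apply: ler_wpM2l.
  by rewrite divr_ge0 // exprn_ge0.
have -> : expR 1 = expR L%:R^-1 ^+ L :> R by rewrite -expRM_natl divff // lt0r_neq0.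
by apply: lerXn2r; rewrite ?nnegrE ?expR_ge0 ?expR_ge1Dx.
Qed.

(** The range where [n] is large and [Delta] is at most a small power of [n]. The exponent
    [(d - 2) / (2 * d - 2)] increases with [d], and [c0] is its value at [2 + eps]. *)
Lemma tww_le_bound_large (R : realType) (eps B : R) (T : finType) (G : graph T) (d : R)
    (Delta : nat) :
  0 < eps -> 1 <= B -> (0 < #|T|)%N -> 2 + eps <= d ->
  (forall A : {set {set T}}, A \subset edges G -> 2 * #|A|%:R <= d * #|finset.cover A|%:R) ->
  (forall u, #|[set v | adj G u v]%SET| <= Delta)%N ->
  let Lam : R := ln #|T|%:R in let c0 : R := eps / (2 + 2 * eps) in
  let P : R := 2 * ln (4 * B) + 3 in
  Delta%:R <= B * (d + Lam) ->
  2 / ((3 / 4 * c0) ^+ 4 / 768) + 2 <= Lam ->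
  ln (Delta%:R + 2) <= c0 / 8 * Lam ->
  (tww G)%:R <= tww_bound (26 + P + 16 * P / c0) #|T| d.
Proof.
move=> eps0 B1 T0 d2e dens deg Lam c0 P degB big aL.
have d2 : 2 <= d by lra.
have d0 : 0 < d by lra.
have c00 : 0 < c0 by rewrite divr_gt0 //; lra.
have c01 : c0 <= 1 by rewrite ler_pdivrMr; lra.
have Lam2 : 2 <= Lam.
  apply: le_trans big; rewrite lerDr; apply: divr_ge0; first by lra.
  by apply: divr_ge0; [apply: exprn_ge0|]; lra.
have Lam1 : 1 <= Lam by lra.
have Lam0 : 0 < Lam by lra.
have [Y2 Yd YL YqL Yqd] := budget_bounds Lam1 d2.
set Y := budget Lam d in Y2 Yd YL YqL Yqd.
have aP : ln (Delta%:R + 2) <= P * Y by exact: ln_degree.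
set a := ln (Delta%:R + 2) in aL aP.
have l2 := @ln2_ge R; have l2' := @ln2_le R.
have D2 : 0 < Delta%:R + 2 :> R by rewrite ltr_wpDl.
have a2 : 1 / 2 <= a.
  by apply: le_trans l2 _; rewrite ler_ln ?posrE // lerDr.
have ea : expR a = Delta%:R + 2 by rewrite lnK ?posrE.
have en : expR Lam = #|T|%:R by rewrite lnK ?posrE ?ltr0n.
have SE (j : nat) : j.+1%:R = j%:R + 1 :> R by rewrite natr1.
have tr (x : R) : 0 <= x -> (Num.truncn x)%:R <= x /\ x <= (Num.truncn x)%:R + 1.
  by move=> x0; rewrite natr1 truncn_le x0 ltW // truncnS_gt.
have [q qE] : {q : R | q = Num.sqrt Lam / d} by exists (Num.sqrt Lam / d).
rewrite -qE in YqL Yqd.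
have s0 : 0 < Num.sqrt Lam by rewrite sqrtr_gt0.
have q0 : 0 <= q by rewrite qE divr_ge0 // ltW.
(* The largest [k] for which the piece size [(Delta + 2) ^ (2 * k)] stays within [n ^ (c0 / 4)]. *)
have [k [k1 k2 k_gt0]] : exists k : nat, [/\ k%:R * a <= c0 / 8 * Lam,
    c0 / 8 * Lam <= 2 * k%:R * a & (0 < k)%N].
  have a0 : 0 < a by lra.
  have x1 : 1 <= c0 / 8 * Lam / a by rewrite ler_pdivlMr // mul1r.
  have x0 : 0 <= c0 / 8 * Lam / a by lra.
  have kg : (0 < Num.truncn (c0 / 8 * Lam / a))%N by rewrite truncn_gt0.
  have [t1 t2] := tr _ x0.
  exists (Num.truncn (c0 / 8 * Lam / a)); split=> //; first by rewrite -ler_pdivlMr.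
  rewrite -ler_pdivrMr //; have : 1 <= (Num.truncn (c0 / 8 * Lam / a))%:R :> R by rewrite ler1n.
  by lra.
have [k0 [k01 k02 k0_gt0]] : exists k0 : nat, [/\ q <= k0%:R, k0%:R <= q + 1 & (0 < k0)%N].
  have [t1 t2] := tr _ q0.
  exists (Num.truncn q).+1; split=> //; rewrite (SE (Num.truncn _)) //.
  by lra.
have [D [D1 D3]] : exists D : nat, k0%:R * d / 2 <= D%:R <= k0%:R * d / 2 + 1 /\ (k0 <= D)%N.
  have x0 : 0 <= k0%:R * d / 2 by rewrite !mulr_ge0 // ltW.
  have [t1 t2] := tr _ x0.
  exists (Num.truncn (k0%:R * d / 2)).+1; split.
    by rewrite (SE (Num.truncn _)) t2 lerD2r.
  rewrite -(ler_nat R) (SE (Num.truncn _)); apply: le_trans t2.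
  by have : 0 <= k0%:R :> R by []; nra.
have D0 : (0 < D)%N by apply: leq_trans k0_gt0 D3.
pose alpha := (d - 2) / (2 * d - 2); pose beta := d / (2 * d - 2).
have dd : 0 < 2 * d - 2 by lra.
have ab : alpha + beta = 1 by rewrite /alpha /beta; field; apply: lt0r_neq0.
have c0a : c0 <= alpha.
  rewrite /alpha ler_pdivlMr // /c0 mulrAC ler_pdivrMr; last by lra.
  by nra.
have a1 : alpha <= 1 / 2 by rewrite ler_pdivrMr //; lra.
have bd : beta * (1 - 2 / d) = alpha.
  by rewrite /alpha /beta; field; rewrite !lt0r_neq0.
(* Up to a factor 2, [2 ^ L] is [n ^ beta], so the classes have about [n ^ alpha] vertices. *)
have [L [L1 L2 L_gt0]] : exists L : nat, [/\ L%:R * ln 2 <= beta * Lam,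
    beta * Lam <= L%:R * ln 2 + ln 2 & (0 < L)%N].
  have l0 : 0 < ln 2 :> R by lra.
  have x1 : 1 <= beta * Lam / ln 2 by rewrite ler_pdivlMr // mul1r; nra.
  have x0 : 0 <= beta * Lam / ln 2 by lra.
  have [t1 t2] := tr _ x0.
  exists (Num.truncn (beta * Lam / ln 2)); split; last by rewrite truncn_gt0.
    by rewrite -ler_pdivlMr.
  by move: t2; rewrite ler_pdivrMr // mulrDl mul1r.
have abL : alpha * Lam + beta * Lam = Lam by rewrite -mulrDl ab mul1r.
have nLE : #|T|%:R / 2 ^+ L = expR (Lam - L%:R * ln 2) :> R.
  by rewrite -en natrX2E -expRB.
have nL : expR (alpha * Lam) <= #|T|%:R / 2 ^+ L by rewrite nLE ler_expR; clear - abL L1 L2; lra.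
have nL' : #|T|%:R / 2 ^+ L <= expR (alpha * Lam + ln 2).
  by rewrite nLE ler_expR; clear - abL L1 L2; lra.
have KE : (Delta.+2 ^ (2 * k))%:R = expR ((2 * k)%:R * a) :> R.
  by rewrite expRM_natl ea natrX -addn2 natrD.
have K0 : (0 < Delta.+2 ^ (2 * k))%N by rewrite expn_gt0.
have L0 : 0 < L%:R :> R by rewrite ltr0n.
have cond : 2 * #|T|%:R * expR (- (L%:R^-1 ^+ 2 * (#|T|%:R / 2 ^+ L) /
    (8 * (Delta.+2 ^ (2 * k))%:R))) < 1 :> R.
  apply: (@colouring_condition R #|T| L _ c0) => //.
  - have : L%:R * (1 / 2) <= L%:R * ln 2 :> R by apply: ler_wpM2l.
    have : beta * Lam <= 1 * Lam.
      by apply: ler_wpM2r; [exact: ltW|rewrite ler_pdivrMr //; clear - d2; lra].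
    by rewrite -/Lam; clear - L1; lra.
  - apply: le_trans nL; rewrite ler_expR; apply: ler_wpM2r => //; exact: ltW.
  - by rewrite KE ler_expR natrM -/Lam; clear - k1; lra.
have eta02 : 0 < (L%:R^-1 : R) <= 2.
  rewrite invr_gt0 L0 /=; apply: le_trans (_ : 1 <= _); last by rewrite ler1n.
  by rewrite invf_le1 // ler1n.
set x : R := #|T|%:R * ((1 + L%:R^-1) / 2) ^+ L.
have xE : x <= expR (alpha * Lam + 2).
  apply: le_trans (compound_halving _ L_gt0) _ => //.
  have -> : alpha * Lam + 2 = (alpha * Lam + 1) + 1 by ring.
  rewrite expRD; apply: ler_wpM2r; first exact: expR_ge0.
  by apply: le_trans nL' _; rewrite ler_expR; clear - l2'; lra.
have x0 : 0 <= x.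
  by rewrite mulr_ge0 // exprn_ge0 // divr_ge0 // addr_ge0 // invr_ge0.
have [s1' s2'] := tr _ x0.
have tww_max : (tww G <= maxn (Num.truncn x * Delta)
    ((D * k) ^ k0 * 2 ^ (L - k0 * (L %/ D - (L %/ D %/ k).+1)).+1))%N.
  apply: tww_le => // [A AE|rho fib].
    rewrite -(ler_nat R) !natrM; have := dens A AE.
    have c1 : 0 <= #|finset.cover A|%:R :> R by [].
    have : 0 <= k0%:R :> R by [].
    case/andP: D1 => D1 _.
    have : k0%:R * d / 2 * #|finset.cover A|%:R <= D%:R * #|finset.cover A|%:R :> R.
      exact: ler_wpM2r.
    move=> h1 h2 h3; apply: le_trans h1.
    by have := ler_wpM2l h2 h3; clear; lra.
  have [chi cls] := balanced_colouring K0 fib eta02 cond.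
  by exists chi => u; rewrite truncn_ge_nat.
rewrite tww_boundE // -/Lam -/alpha -/Y.
have P0 : 3 <= P.
  by rewrite lerDr mulr_ge0 // ln_ge0 //; clear - B1; lra.
have PY : 0 <= P * Y by rewrite mulr_ge0 //; [clear - P0|clear - Y2]; lra.
have PYc : 0 <= 16 * (P * Y / c0) by rewrite mulr_ge0 // divr_ge0 // ltW.
have split_C : (26 + P + 16 * P / c0) * Y = 26 * Y + P * Y + 16 * (P * Y / c0) by ring.
rewrite split_C; move: tww_max; rewrite leq_max => /orP[] le.
  apply: le_trans (_ : (Num.truncn x * Delta)%:R <= _); first by rewrite ler_nat.
  rewrite natrM; apply: le_trans (_ : expR (alpha * Lam + 2) * expR a <= _).
    by apply: ler_pM => //; [exact: le_trans xE|rewrite ea lerDl].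
  by rewrite -expRD ler_expR; clear - aP Y2 PYc; lra.
apply: le_trans (_ : _%:R <= _); first by rewrite ler_nat; exact: le.
rewrite natrM !natrX natrX2E.
have Dk0 : 0 < (D * k)%:R :> R by rewrite ltr0n muln_gt0 D0.
rewrite -[(D * k)%:R]lnK ?posrE // -expRM_natl -expRD ler_expR.
rewrite qE in k01 k02.
apply: le_trans (code_exponent Lam2 d2 k_gt0 k0_gt0 D3 k01 k02 D1 c00 c01 a2 k1 k2 aP L1) _.
by rewrite -/Y -/alpha; clear - PY; lra.
Qed.

(** Outside the range of [tww_le_bound_large], either [n] is bounded or [Delta + 2] exceeds a fixed
    power of [n]. In both cases a constant multiple of the budget exceeds [ln n], and [tww G <= n]
    suffices. *)
Lemma tww_le_bound (R : realType) (eps B : R) : 0 < eps -> 1 <= B ->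
  exists C : R, 0 < C /\ forall (T : finType) (G : graph T) (d : R) (Delta : nat),
    (4 <= #|T|)%N -> 2 + eps <= d ->
    (forall A : {set {set T}}, A \subset edges G ->
       2 * #|A|%:R <= d * #|finset.cover A|%:R) ->
    (forall u, #|[set v | adj G u v]%SET| <= Delta)%N ->
    Delta%:R <= B * (d + ln #|T|%:R) ->
    (tww G)%:R <= tww_bound C #|T| d.
Proof.
move=> eps0 B1; pose c0 : R := eps / (2 + 2 * eps); pose P : R := 2 * ln (4 * B) + 3.
pose Lam0 : R := 2 / ((3 / 4 * c0) ^+ 4 / 768) + 2.
have c0_gt0 : 0 < c0 by rewrite divr_gt0 //; lra.
have P3 : 3 <= P by rewrite lerDr mulr_ge0 // ln_ge0 //; lra.
have Lam0_gt0 : 0 < Lam0.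
  apply: addr_gt0; last by lra.
  by apply: divr_gt0; [lra|apply: divr_gt0; [apply: exprn_gt0|]; lra].
have PC : 0 < P / c0 by rewrite divr_gt0 //; lra.
have C0_gt0 : 0 < 26 + P + 16 * P / c0 by rewrite -mulrA; lra.
exists (26 + P + 16 * P / c0 + 2 * Lam0 + 8 * (P / c0)); split; first by lra.
move=> T G d Delta n4 d2e dens deg degB.
have d2 : 2 <= d by lra.
have T0 : (0 < #|T|)%N by apply: leq_trans n4.
have Lam1 : 1 <= ln #|T|%:R :> R.
  apply: le_trans (_ : ln (2 * 2) <= _).
    by rewrite lnM ?posrE //; have := @ln2_ge R; lra.
  by rewrite ler_ln ?posrE ?ltr0n // -natrM ler_nat.
have [Y2 _ _ _ _] := budget_bounds Lam1 d2.
set Y := budget _ d in Y2.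
have alpha0 : 0 <= (d - 2) / (2 * d - 2) by rewrite divr_ge0; lra.
have aL0 : 0 <= (d - 2) / (2 * d - 2) * ln #|T|%:R by rewrite mulr_ge0 //; lra.
have pos x : 0 < x -> 0 <= x * Y by move=> x0; rewrite mulr_ge0 //; lra.
have CE : (26 + P + 16 * P / c0 + 2 * Lam0 + 8 * (P / c0)) * Y =
    (26 + P + 16 * P / c0) * Y + 2 * (Lam0 * Y) + 8 * (P / c0 * Y) by ring.
have [CY0 PY0 LY0] := And3 (pos _ C0_gt0) (pos _ PC) (pos _ Lam0_gt0).
have trivial_bound (x : R) : ln #|T|%:R <= x -> (tww G)%:R <= expR x.
  move=> le; apply: le_trans (_ : #|T|%:R <= _); first by rewrite ler_nat tww_le_card.
  by rewrite -[leLHS]lnK ?posrE ?ltr0n // ler_expR.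
have [LamB|LamS] := leP Lam0 (ln #|T|%:R); last first.
  rewrite tww_boundE //; apply: trivial_bound; rewrite -/Y CE.
  have : Lam0 * 1 <= Lam0 * (2 * Y) by apply: ler_wpM2l; [exact: ltW|lra].
  by clear - LamS CY0 PY0 LY0 aL0; lra.
have [aL|aB] := leP (ln (Delta%:R + 2)) (c0 / 8 * ln #|T|%:R).
  apply: le_trans (tww_le_bound_large eps0 B1 T0 d2e dens deg degB LamB aL) _.
  rewrite !tww_boundE // ler_expR lerD2l; apply: ler_wpM2r; first by rewrite -/Y; lra.
  by rewrite -/P -/c0; clear - PC Lam0_gt0; lra.
rewrite tww_boundE //; apply: trivial_bound; rewrite -/Y CE.
have aP := ln_degree B1 Lam1 d2 degB; rewrite -/Y -/P in aP.
have : ln #|T|%:R <= 8 * (P / c0 * Y).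
  have -> : 8 * (P / c0 * Y) = P * Y * 8 / c0 by ring.
  by rewrite ler_pdivlMr //; clear - aB aP; lra.
by clear - CY0 LY0 aL0; lra.
Qed.

(** * Regular graphs *)

Lemma tww_empty (T : finType) (G : graph T) : #|T| = 0%N -> tww G = 0%N.
Proof.
move=> T0; have no (H : trigraph) w : #|H| = 0%N -> ~ contraction_seq w H.
  move=> H0 seqH; case: seqH H0 => [H' ->//|H' u _ _ _ _ H0].
  by have := fintype0 u H0.
rewrite /tww; case: pselect => // ex; have [w /asboolP seqw] := ex.
by case: (no _ _ _ seqw).
Qed.

Lemma card_edges_at (T : finType) (G : graph T) (u : T) :
  (#|[set e in edges G | u \in e]%SET| <= #|[set v | adj G u v]%SET|)%N.
Proof.
apply: leq_trans (leq_imset_card (fun v => [set u; v]%SET) _).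
apply/subset_leq_card/fintype.subsetP => e; rewrite inE => /andP[eG ue].
have := fintype.subsetP (edges_card2 G) _ eG; rewrite inE (cardsD1 u) ue eqSS.
case/cards1P => v vE; have eE : e = [set u; v]%SET by rewrite -(finset.setD1K ue) vE.
by apply/imsetP; exists v; rewrite // inE /adj -eE.
Qed.

(** Double counting of the incidences between edges in [A] and their ends. *)
Lemma regular_density (T : finType) (d : nat) (G : graph T) (A : {set {set T}}) :
  regular d G -> A \subset edges G -> (2 * #|A| <= d * #|finset.cover A|)%N.
Proof.
move=> reg AG.
have -> : (2 * #|A|)%N = (\sum_(e in A) \sum_(u in finset.cover A | u \in e) 1)%N.
  rewrite mulnC -sum_nat_const; apply: eq_bigr => e eA.
  have /eqP <- : #|e| == 2%N.
    by have := fintype.subsetP (fintype.subset_trans AG (edges_card2 G)) _ eA; rewrite inE.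
  rewrite sum1dep_card; apply: eq_card => u; rewrite !inE.
  by apply/esym/andb_idl => ue; apply/bigcupP; exists e.
rewrite (exchange_big_dep (mem (finset.cover A))) /=; last by move=> e u _ /andP[].
rewrite mulnC -sum_nat_const; apply: leq_sum => u uA.
rewrite sum1dep_card -(reg u); apply: leq_trans (card_edges_at G u).
apply/subset_leq_card/fintype.subsetP => e; rewrite !inE => /and3P[eA _ ue].
by rewrite ue (fintype.subsetP AG).
Qed.

Lemma tww_regular (R : realType) : exists C : R, 0 < C /\
  forall (d : nat) (T : finType) (G : graph T), (2 < d)%N -> regular d G ->
    (tww G)%:R <= tww_bound C #|T| d%:R.
Proof.
have [C [C0 HC]] := @tww_le_bound R 1 1 ltr01 (lexx 1).
exists C; split=> // d T G d2 reg.
have [T0|/card_gt0P[u _]] := posnP #|T|.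
  by rewrite tww_empty // mulr_ge0 ?powR_ge0 ?expR_ge0.
have n4 : (4 <= #|T|)%N.
  apply: leq_trans (_ : d.+1 <= _)%N => //.
    rewrite -(reg u) -cardsT (cardsD1 u [set: T]%SET) finset.in_setT add1n ltnS.
  apply/subset_leq_card/fintype.subsetP => v; rewrite !inE andbT => uv.
  by apply: contraTneq uv => ->; rewrite adj_irrefl.
apply: (HC T G d%:R d) => //.
- by rewrite -[2 + 1]/(2%:R + 1%:R) -natrD ler_nat.
- by move=> A AG; rewrite -!natrM ler_nat (regular_density reg AG).
- by move=> v; rewrite reg.
by rewrite mul1r lerDl ln_ge0 // ler1n; apply: leq_trans n4.
Qed.

(** * Random graphs *)

(** The vertices covered by [A] together with [A] form one of the subgraphs in the maximum defining
    [mad]. *)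
Lemma mad_density (R : realType) (T : finType) (G : graph T) (A : {set {set T}}) :
  A \subset edges G -> 2 * #|A|%:R <= mad R G * #|finset.cover A|%:R.
Proof.
move=> AG; have [->|A0] := eqVneq A finset.set0.
  rewrite cards0 mulr0 mulr_ge0 // /mad.
  by elim/big_ind: _ => // x y x0 y0; rewrite le_max x0.
have [e eA] := set0Pn _ A0.
have c0 : (0 < #|finset.cover A|)%N.
  have : (0 < #|e|)%N.
    by have := fintype.subsetP (edges_card2 G) _ (fintype.subsetP AG _ eA);
      rewrite inE => /eqP->.
  by move/leq_trans; apply; apply/subset_leq_card/finset.bigcup_sup.
rewrite -ler_pdivrMr ?ltr0n //.
have H : nonempty_subgraph G (finset.cover A, A).
  by rewrite /nonempty_subgraph /= c0 AG; apply/forall_inP => x xA; apply: finset.bigcup_sup.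
exact: (le_bigmax_cond _ _ H).
Qed.

Lemma mad_ge (R : realType) (T : finType) (G : graph T) : (0 < #|T|)%N ->
  2 * #|edges G|%:R / #|T|%:R <= mad R G.
Proof.
move=> T0; rewrite -cardsT.
have H : nonempty_subgraph G ([set: T]%SET, edges G).
  by rewrite /nonempty_subgraph /= cardsT T0 fintype.subxx; apply/forall_inP => x _;
     exact: finset.subsetT.
exact: (le_bigmax_cond _ _ H).
Qed.

Lemma expR1_le4 (R : realType) : expR 1 <= 4 :> R.
Proof.
have -> : 4 = expR (ln 2 + ln 2) :> R.
  by rewrite expRD lnK ?posrE // -natrM.
by rewrite ler_expR; have := @ln2_ge R; lra.
Qed.

(** Combine [t ^ t / t! <= exp t] with [lam <= t / 16 <= t * exp (- 2)]. *)
Lemma pow_div_fact_le (R : realType) (lam : R) (t : nat) : (0 < t)%N -> 0 <= lam ->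
  16 * lam <= t%:R -> lam ^+ t / t`!%:R <= expR (- t%:R).
Proof.
case: t => // t _ lam0 le16.
have t0 : 0 < t.+1%:R :> R by rewrite ltr0n.
have e4 := @expR1_le4 R; have e0 := expR_gt0 (1 : R).
have f0 : 0 < t.+1`!%:R :> R by rewrite ltr0n fact_gt0.
have lamE : lam <= t.+1%:R * expR (- 2).
  rewrite -[X in _ <= _ * expR X]opprK opprK expRN ler_pdivlMr ?expR_gt0 //.
  have -> : 2 = 1 + 1 :> R by [].
  have e16 : expR (1 : R) * expR 1 <= 16 by nra.
  by rewrite expRD; have := ler_wpM2l lam0 e16; lra.
have h : t.+1%:R ^+ t.+1 / t.+1`!%:R <= expR t.+1%:R :> R.
  by apply: le_trans (expR_ge1Dxn t (ltW t0)); rewrite lerDr.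
apply: le_trans (_ : (t.+1%:R * expR (- 2)) ^+ t.+1 / t.+1`!%:R <= _).
  apply: ler_wpM2r; first by rewrite invr_ge0 ltW.
  by apply: lerXn2r; rewrite ?nnegrE // mulr_ge0 ?expR_ge0 // ltW.
rewrite exprMn -expRM_natl mulrAC.
have -> : - t.+1%:R = t.+1%:R + t.+1%:R * (- 2) :> R by ring.
by rewrite expRD; apply: ler_wpM2r; first exact: expR_ge0.
Qed.

(** From [card_graphs_degree], using ['C(n, t) <= n ^ t / t!] and
    [n * m / 'C(n, 2) = 2 * m / (n - 1)]. *)
Lemma prob_large_degree (R : realType) (n m t : nat) (v : 'I_n) :
  (1 < n)%N -> (m <= 'C(n, 2))%N ->
  #|[set G : graph 'I_n | (#|edges G| == m) && (t <= #|[set u | adj G v u]%SET|)%N]%SET|%:R <=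
  (2 * m%:R / (n%:R - 1)) ^+ t / t`!%:R *
    #|[set G : graph 'I_n | #|edges G| == m]%SET|%:R :> R.
Proof.
move=> n1 mN; have := @card_graphs_degree 'I_n v m t; rewrite card_ord => /(_ mN).
set bad := #|_|; set tot := #|_| => h.
have NE : ('C(n, 2))%:R * 2 = n%:R * (n%:R - 1) :> R.
  have -> : n%:R - 1 = n.-1%:R :> R by rewrite -subn1 natrB // ltnW.
  by rewrite -[RHS]natrM -[in RHS](bin1 n.-1) mul_bin_diag natrM mulrC.
have n0 : 0 < n%:R :> R by rewrite ltr0n ltnW.
have n1' : 0 < n%:R - 1 :> R by rewrite subr_gt0 ltr1n.
have N0 : 0 < ('C(n, 2))%:R :> R by rewrite ltr0n bin_gt0.
have f0 : 0 < t`!%:R :> R by rewrite ltr0n fact_gt0.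
have {}h : (bad * 'C(n, 2) ^ t * t`! <= n ^ t * (m ^ t * tot))%N.
  apply: leq_trans (leq_mul h (leqnn _)) _.
  rewrite mulnAC; apply: leq_mul => //; rewrite bin_ffact ffact_prod.
  rewrite -[t in (n ^ t)%N]card_ord -prod_nat_const.
  by apply: leq_prod => i _; apply: leq_subr.
have -> : 2 * m%:R / (n%:R - 1) = n%:R * m%:R / ('C(n, 2))%:R :> R.
  have -> : ('C(n, 2))%:R = n%:R * (n%:R - 1) / 2 :> R by rewrite -NE mulfK.
  by field; rewrite !lt0r_neq0.
have quot (a b c e : R) : a / b / c * e = a * e / (b * c) by rewrite invfM; ring.
rewrite expr_div_n quot ler_pdivlMr ?mulr_gt0 ?exprn_gt0 // exprMn.
by move: h; rewrite -(ler_nat R) !natrM !natrX !mulrA.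
Qed.

(** A given vertex has degree at least [t] with probability at most [exp (- t) <= n ^ (- 2)];
    summing over the vertices gives [1 / n]. *)
Lemma prob_Gnm_ge (R : realType) (n m t : nat) (P : pred (graph 'I_n)) :
  (1 < n)%N -> (m <= 'C(n, 2))%N -> (0 < t)%N ->
  16 * (2 * m%:R / (n%:R - 1)) <= t%:R :> R -> 2 * ln n%:R <= t%:R :> R ->
  (forall G : graph 'I_n, #|edges G| = m ->
    (forall v, #|[set u | adj G v u]%SET| < t)%N -> P G) ->
  1 - n%:R^-1 <= prob_Gnm R m P <= 1.
Proof.
move=> n1 mN t0 t16 tln good.
have n0 : 0 < n%:R :> R by rewrite ltr0n ltnW.
have n1' : 0 < n%:R - 1 :> R by rewrite subr_gt0 ltr1n.
rewrite /prob_Gnm; set all := [set G : graph 'I_n | #|edges G| == m]%SET.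
set yes := [set G | _ && _]%SET.
have tot0 : 0 < #|all|%:R :> R.
  by rewrite ltr0n card_graphs card_ord bin_gt0.
have yall : yes \subset all.
  by apply/fintype.subsetP => G; rewrite !inE => /andP[].
apply/andP; split; last first.
  by rewrite ler_pdivrMr // mul1r ler_nat subset_leq_card.
pose B v := [set G : graph 'I_n | (#|edges G| == m) && (t <= #|[set u | adj G v u]%SET|)%N]%SET.
have sub : (all :\: yes)%SET \subset (\bigcup_(v | true) B v)%SET.
  apply/fintype.subsetP => G; rewrite !inE => /andP[+ Gm]; rewrite Gm /= => nP.
  apply/finset.bigcupP; apply: contrapT => no; move/negP: nP; apply; apply: good.
    exact/eqP.
  by move=> v; rewrite ltnNge; apply/negP => tv; apply: no; exists v; rewrite // inE Gm.
have cardB v : #|B v|%:R <= n%:R^-1 ^+ 2 * #|all|%:R :> R.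
  apply: le_trans (prob_large_degree R t v n1 mN) _; apply: ler_wpM2r; first exact: ltW.
  apply: le_trans (pow_div_fact_le t0 _ t16) _.
    by rewrite divr_ge0 ?mulr_ge0 // ltW.
  rewrite -[X in X^-1]lnK ?posrE // -expRN -expRM_natl ler_expR; lra.
have : #|(all :\: yes)%SET|%:R <= n%:R^-1 * #|all|%:R :> R.
  apply: le_trans (_ : \sum_v #|B v|%:R <= _).
    rewrite -natr_sum ler_nat; apply: leq_trans (subset_leq_card sub) _.
    apply: (big_ind2 (fun (X : {set graph 'I_n}) k => #|X| <= k)%N) => //.
      by rewrite cards0.
    by move=> X1 k1 X2 k2 ? ?; apply: leq_trans (leq_card_setU _ _) (leq_add _ _).
  apply: le_trans (ler_sum _ (fun v _ => cardB v)) _.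
  rewrite sumr_const card_ord -[leLHS]mulr_natl.
  by rewrite (_ : n%:R * _ = n%:R^-1 * #|all|%:R) //; field; apply: lt0r_neq0.
rewrite cardsDS // natrB ?subset_leq_card // ler_pdivlMr //; lra.
Qed.

Theorem theorem1p4 (R : realType) :
  (exists C : R, 0 < C /\
    forall (d : nat) (T : finType) (G : graph T),
      (2 < d)%N -> regular d G ->
      (tww G)%:R <= tww_bound C #|T| d%:R)
  /\
  (forall eps : R, 0 < eps ->
    exists C : R, 0 < C /\
    forall m : nat -> nat,
      (\forall n \near \oo,
         (1 + eps) * n%:R <= (m n)%:R /\ (m n <= 'C(n, 2))%N) ->
      (fun n : nat =>
         prob_Gnm R (m n)
           (fun G : graph 'I_n => (tww G)%:R <= tww_bound C n (mad R G)))
        @ \oo --> (1 : R)).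
Proof.
split; first exact: tww_regular.
(* With high probability the maximum degree is at most [32 * d + 2 * ln n], which [B = 65]
   covers. *)
move=> eps eps0; have [|C [C0 HC]] := @tww_le_bound R eps 65 eps0; first by lra.
exists C; split=> // m mP.
(* [harmonic] is [1 / (n + 1)]; twice it dominates the failure probability [1 / n]. *)
have lim : (fun n => 1 - 2 * @harmonic R n) @ \oo --> (1 : R).
  rewrite -[X in _ --> X]subr0 -[X in _ --> _ - X](mulr0 2).
  by apply: cvgB; [exact: cvg_cst|apply: cvgMr; exact: cvg_harmonic].
apply: (@squeeze_cvgr _ _ _ R _ (fun=> 1) _ _ _ lim (cvg_cst _)); near=> n.
have [mn mN] : (1 + eps) * n%:R <= (m n)%:R /\ (m n <= 'C(n, 2))%N by near: n.
have n4 : (4 <= n)%N by near: n; exists 4%N.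
have n4R : 4 <= n%:R :> R by rewrite ler_nat.
have ln1 : 1 <= ln n%:R :> R.
  apply: le_trans (_ : ln (2 * 2) <= _).
    by rewrite lnM ?posrE //; have := @ln2_ge R; lra.
  by rewrite ler_ln ?posrE; lra.
(* The sum meets both lower bounds on the threshold in [prob_Gnm_ge]. Degrees below [(truncn x).+1]
   are at most [truncn x], which serves as [Delta]. *)
pose x : R := 16 * (2 * (m n)%:R / (n%:R - 1)) + 2 * ln n%:R.
have y0 : 0 <= 2 * (m n)%:R / (n%:R - 1) :> R by rewrite divr_ge0 //; lra.
have x0 : 0 <= x by rewrite /x; lra.
have [t1 t2] : (Num.truncn x)%:R <= x /\ x <= (Num.truncn x).+1%:R.
  by rewrite truncn_le x0 ltW // truncnS_gt.
have /andP[p1 ->] : 1 - n%:R^-1 <=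
    prob_Gnm R (m n) (fun G : graph 'I_n => (tww G)%:R <= tww_bound C n (mad R G)) <= 1.
  apply: (@prob_Gnm_ge R n (m n) (Num.truncn x).+1) => //.
  - by apply: leq_trans n4.
  - by rewrite /x in t2; lra.
  - by rewrite /x in t2; lra.
  move=> G Gm deg.
  have n0 : (0 < #|'I_n|)%N by rewrite card_ord (leq_trans _ n4).
  have := @mad_ge R 'I_n G n0; rewrite Gm card_ord => madG.
  have nR0 : 0 < n%:R :> R by lra.
  have mad2 : 2 + eps <= mad R G.
    apply: le_trans madG; rewrite ler_pdivlMr //.
    have : 0 <= eps * n%:R by rewrite mulr_ge0 // ltW.
    by lra.
  have := HC 'I_n G (mad R G) (Num.truncn x); rewrite card_ord; apply=> //.
    exact: mad_density.
  apply: le_trans t1 _; rewrite /x.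
  have : 2 * (m n)%:R / (n%:R - 1) <= 2 * (2 * (m n)%:R / n%:R) :> R.
    rewrite ler_pdivrMr; last by lra.
    have -> : 2 * (2 * (m n)%:R / n%:R) * (n%:R - 1) =
      2 * (m n)%:R * (2 * (n%:R - 1) / n%:R) :> R by ring.
    apply: ler_peMr; first by rewrite mulr_ge0.
    by rewrite ler_pdivlMr //; lra.
  by lra.
rewrite andbT; apply: le_trans p1; rewrite lerD2l lerN2 /harmonic.
have -> : 2 * n.+1%:R^-1 = (n.+1%:R / 2)^-1 :> R by rewrite invf_div.
have -> : n.+1%:R = n%:R + 1 :> R by rewrite natr1.
by rewrite lef_pV2 ?posrE; lra.
Unshelve. all: by end_near.
Qed.
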